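(* Let $T>0$. The estimate $\|\mathcal E(t)F_0\|_{L^2_xL^\infty_{yzT}}\le c(T,s)\|F_0\|_{H^s(\mathbb R^3)}$ fails for $s<1$: for each $s<1$ and every constant $c>0$ there exists $F_0\in H^s(\mathbb R^3)$ such that $$\|\mathcal E(t)F_0\|_{L^2_xL^\infty_{yzT}}> c\,\|F_0\|_{H^s(\mathbb R^3)}.$$
   Context: Points of $\mathbb R^3$ are $(x,y,z)$ with dual variables $\xi=(\xi_1,\xi_2,\xi_3)$. $\mathcal E(t)$ is the unitary group $\mathcal E(t)f=\big(e^{-it(\xi_1^2+\xi_2^2+\xi_3)}\widehat f(\xi)\big)^\vee$, where $\widehat{\ }$ and ${}^\vee$ denote the spatial Fourier transform and its inverse. $H^s(\mathbb R^3)$ is the usual $L^2$-based Sobolev space. $\|f\|_{L^2_xL^\infty_{yzT}}=\big(\int_{\mathbb R}\sup_{y,z\in\mathbb R,\,t\in[0,T]}|f(x,y,z,t)|^2\,dx\big)^{1/2}$ (essential supremum). *)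

(* Defs.v *)
From HB Require Import structures.
From mathcomp Require Import all_boot all_order all_algebra.
From mathcomp Require Import all_classical all_reals all_analysis ess_sup_inf.
From mathcomp Require Export complex.
Set Implicit Arguments.
Unset Strict Implicit.
Unset Printing Implicit Defensive.
Import Order.TTheory GRing.Theory Num.Theory numFieldNormedType.Exports.
Local Open Scope classical_set_scope.
Local Open Scope complex_scope.
Local Open Scope ring_scope.

Section Euclidean3.
Context {R : realType}.

(* A point (x, y, z) of R^3 is ((x, y), z), with coordinates p.1.1, p.1.2, p.2. *)
Definition leb2 := ((@lebesgue_measure R) \x (@lebesgue_measure R))%E.
Definition leb3 := (leb2 \x (@lebesgue_measure R))%E.

Definition dot3 (p q : R * R * R) : R :=
  p.1.1 * q.1.1 + p.1.2 * q.1.2 + p.2 * q.2.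

Definition bracket2 (p : R * R * R) : R := 1 + dot3 p p.

Definition basis3 (j : 'I_3) : R * R * R :=
  ((j == 0 :> nat)%:R, (j == 1 :> nat)%:R, (j == 2 :> nat)%:R).

End Euclidean3.

Section ComplexValued.
Context {R : realType}.

Definition expi (theta : R) : R[i] := cos theta +i* sin theta.

Definition cmodulus (w : R[i]) : R := ComplexField.Normc.normc w.

Definition cmeasurable d (X : measurableType d) (f : X -> R[i]) : Prop :=
  measurable_fun setT (fun x => complex.Re (f x)) /\
  measurable_fun setT (fun x => complex.Im (f x)).

Definition cintegrable d (X : measurableType d)
    (mu : {measure set X -> \bar R}) (f : X -> R[i]) : Prop :=
  mu.-integrable setT (fun x => (complex.Re (f x))%:E) /\
  mu.-integrable setT (fun x => (complex.Im (f x))%:E).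

Definition cintegral d (X : measurableType d)
    (mu : {measure set X -> \bar R}) (f : X -> R[i]) : R[i] :=
  Rintegral mu setT (fun x => complex.Re (f x)) +i*
  Rintegral mu setT (fun x => complex.Im (f x)).

End ComplexValued.

Section Schwartz.
Context {R : realType}.
Implicit Types (f phi psi : R * R * R -> R[i]) (j : 'I_3) (w : seq 'I_3).

Definition cderivable f j (p : R * R * R) : Prop :=
  derivable (fun q => complex.Re (f q)) p (basis3 j) /\
  derivable (fun q => complex.Im (f q)) p (basis3 j).

Definition pderiv j f : R * R * R -> R[i] := fun p =>
  'D_(basis3 j) (fun q => complex.Re (f q)) p +i*
  'D_(basis3 j) (fun q => complex.Im (f q)) p.

Definition pderivs w f : R * R * R -> R[i] := foldr pderiv f w.

Definition seminorm (N : nat) f : \bar R :=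
  ereal_sup [set x | exists w p, (size w <= N)%N /\
    x = (bracket2 p ^+ N * cmodulus (pderivs w f p))%:E].

(* Only the existence of all iterated partial derivatives is required: they are
   then continuous, since by the second clause the partial derivatives of each
   of them are bounded. *)
Definition schwartz f : Prop :=
  (forall w j p, cderivable (pderivs w f) j p) /\
  (forall N, (seminorm N f < +oo)%E).

Definition fourier f : R * R * R -> R[i] := fun xi =>
  cintegral leb3 (fun p => f p * expi (- dot3 p xi)).

Definition ifourier f : R * R * R -> R[i] := fun p =>
  (((2 * pi) ^+ 3)^-1)%:C *
    cintegral leb3 (fun xi => f xi * expi (dot3 p xi)).

End Schwartz.

Section TemperedDistributions.
Context {R : realType}.

(* A distribution is a total functional; only its values at Schwartz functions
   are meaningful. *)
Definition distribution3 : Type := (R * R * R -> R[i]) -> R[i].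

Implicit Types (F : distribution3) (g m : R * R * R -> R[i]).

Definition tempered F : Prop :=
  (forall (a : R[i]) phi psi, schwartz phi -> schwartz psi ->
     F (fun p => a * phi p + psi p) = a * F phi + F psi) /\
  (exists (N : nat) (C : R), forall phi, schwartz phi ->
     ((cmodulus (F phi))%:E <= C%:E * seminorm N phi)%E).

Definition represents F g : Prop :=
  cmeasurable g /\
  forall phi, schwartz phi ->
    cintegrable leb3 (fun p => g p * phi p) /\
    F phi = cintegral leb3 (fun p => g p * phi p).

Definition dfourier F : distribution3 := fun phi => F (fourier phi).
Definition difourier F : distribution3 := fun phi => F (ifourier phi).
Definition dmul m F : distribution3 := fun phi => F (fun p => m p * phi p).

(* A function representing the Fourier transform of F is unique up to a null
   set, so the infimum ranges over at most one value; it is +oo when the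
   Fourier transform of F is not a function. *)
Definition sobolev_norm (s : R) F : \bar R :=
  ereal_inf [set x | exists2 g, represents (dfourier F) g &
    x = poweR (\int[leb3]_xi (bracket2 xi `^ s * cmodulus (g xi) ^+ 2)%:E)%E
              2^-1].

Definition sobolev (s : R) F : Prop :=
  tempered F /\ (sobolev_norm s F < +oo)%E.

Definition evolution (t : R) F : distribution3 :=
  difourier (dmul (fun xi => expi (- (t * (xi.1.1 ^+ 2 + xi.1.2 ^+ 2 + xi.2))))
                  (dfourier F)).

(* u p t is a jointly measurable version of E(t)F on R^3 x [0, T]; it is unique
   up to a null set. *)
Definition evolution_function (T : R) F (u : R * R * R -> R -> R[i]) : Prop :=
  cmeasurable (fun q : (R * R * R) * R => u q.1 q.2) /\
  forall t, 0 <= t <= T -> represents (evolution t F) (fun p => u p t).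

End TemperedDistributions.

Section MixedNorm.
Context {R : realType}.

(* The set of all ((y, z), t) with 0 <= t <= T. *)
Definition slab (T : R) : set (R * R * R) := setT `*` `[0, T].

Lemma measurable_slab (T : R) : measurable (slab T).
Proof. by apply: measurableX => //; exact: measurable_itv. Qed.

Definition norm_L2x_LooyzT (T : R) (u : R * R * R -> R -> R[i]) : \bar R :=
  poweR (\int[lebesgue_measure]_x
    (ess_sup (mrestr leb3 (measurable_slab T))
       (fun q => (cmodulus (u (x, q.1.1, q.1.2) q.2))%:E)) ^+ 2)%E 2^-1.

End MixedNorm.

(* Main.v *)
Require Import Defs.
From HB Require Import structures.
From mathcomp Require Import all_boot all_order all_algebra.
From mathcomp Require Import all_classical all_reals all_analysis.
From mathcomp Require Import measurable_realfun ess_sup_inf ring lra.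

(** Already at time [0] the estimate contains the embedding of [H^s] of a plane
    into [L^oo], which fails by scaling when [s < 1]. The initial datum is
    [f_L(x, y, z) = e^(-|x|) e^(-L|y|) e^(-L|z|)]: its Fourier transform [g_L] is
    the product of the Poisson kernels [2a / (a^2 + xi_j^2)] with [a = 1, L, L],
    hence nonnegative, of mass [(2 pi)^3] for all [L], and satisfies
    [(1 + |xi|^2) g_L <= 8] and [g_L <= 8 / L]. Interpolating,
    [(1 + |xi|^2)^s g_L^2 <= eps(L) g_L] with [eps(L) -> 0], so the Sobolev norm
    of [f_L] tends to [0]. On the other hand a fixed proportion (9/10) of the mass
    of [g_L] lies in a box of size [M x M L x M L] with [M] independent of [L];
    when [y, z, t] are small (depending on [L]) and [|x| <= 1 / (4 M)] the phase is
    at most [1] on this box, so [Re u >= 1 / 4] and the mixed norm is bounded below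
    independently of [L].

    Since distributions are tested against Schwartz functions [phi] only, the
    identification of [g_L] and of the evolution [u] rests on the multiplication
    formula, which requires the inverse Fourier transform of [phi] to be
    integrable; this follows from integrations by parts. *)

Set Implicit Arguments.
Unset Strict Implicit.
Unset Printing Implicit Defensive.
Import Order.TTheory GRing.Theory Num.Theory numFieldNormedType.Exports.
Local Open Scope classical_set_scope.
Local Open Scope complex_scope.
Local Open Scope ring_scope.

(** * Integration on products: Fubini for kernels dominated by a tensor product *)

Section DominatedFubini.
Context d1 d2 (X : measurableType d1) (Y : measurableType d2) (R : realType).
Variables (mu : {sigma_finite_measure set X -> \bar R})
          (nu : {sigma_finite_measure set Y -> \bar R}).
Variables (a : X -> R) (b : Y -> R).
Hypothesis ia : mu.-integrable setT (EFin \o a).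
Hypothesis ib : nu.-integrable setT (EFin \o b).

(** By Tonelli, the iterated integral of the absolute value factors into two finite integrals. *)
Lemma integrable_tensor :
  (mu \x nu)%E.-integrable setT (EFin \o (fun p => a p.1 * b p.2)).
Proof.
have ma : measurable_fun setT a by apply/measurable_EFinP; exact: measurable_int ia.
have mb : measurable_fun setT b by apply/measurable_EFinP; exact: measurable_int ib.
apply/integrable12ltyP.
  apply/measurable_EFinP; apply: measurable_funM; exact: measurableT_comp.
rewrite (eq_integral (fun x => `|a x|%:E * \int[nu]_y `|b y|%:E)%E); last first.
  move=> x _; rewrite -ge0_integralZl//.
  - by apply: eq_integral => y _; rewrite /= normrM EFinM.
  - by apply/measurable_EFinP; exact: measurableT_comp.
have/integrableP[_ Ia] := ia; have/integrableP[_ Ib] := ib.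
rewrite ge0_integralZr//.
- by apply: lte_mul_pinfty => //; [exact: integral_ge0 | rewrite ge0_fin_numE//;
  exact: integral_ge0].
- by apply/measurable_EFinP; exact: measurableT_comp.
- exact: integral_ge0.
Qed.

Variable K : X * Y -> R.
Hypothesis mK : measurable_fun setT K.
Hypothesis Kab : forall x y, `|K (x, y)| <= a x * b y.

Lemma dominated_integrable_prod : (mu \x nu)%E.-integrable setT (EFin \o K).
Proof.
apply: le_integrable integrable_tensor => //; first exact/measurable_EFinP.
by move=> [x y] _ /=; rewrite lee_fin (le_trans (Kab x y))// ler_norm.
Qed.

Lemma dominated_integrable_right x : nu.-integrable setT (EFin \o (fun y => K (x, y))).
Proof.
apply: (le_integrable measurableT _ _ (integrableZl measurableT (a x) ib)).
  by apply/measurable_EFinP; exact: (measurableT_comp mK (pair1_measurable x)).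
by move=> y _ /=; rewrite lee_fin (le_trans (Kab x y))// ler_norm.
Qed.

Lemma dominated_integrable_left y : mu.-integrable setT (EFin \o (fun x => K (x, y))).
Proof.
apply: (le_integrable measurableT _ _ (integrableZl measurableT (b y) ia)).
  by apply/measurable_EFinP; exact: (measurableT_comp mK (pair2_measurable y)).
by move=> x _ /=; rewrite lee_fin mulrC (le_trans (Kab x y))// ler_norm.
Qed.

(** The pointwise bound makes every slice integrable, not only almost every one, so each inner
    extended integral is finite and equals its [fine] part. *)
Lemma dominated_Fubini_right : Rintegral (mu \x nu)%E setT K =
  Rintegral mu setT (fun x => Rintegral nu setT (fun y => K (x, y))).
Proof.
rewrite /Rintegral -integral12_prod_meas1; last exact: dominated_integrable_prod.
congr fine; apply: eq_integral => x _.
by rewrite fineK//; apply: integrable_fin_num => //; exact: dominated_integrable_right.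
Qed.

Lemma dominated_Fubini_left : Rintegral (mu \x nu)%E setT K =
  Rintegral nu setT (fun y => Rintegral mu setT (fun x => K (x, y))).
Proof.
rewrite /Rintegral -integral21_prod_meas1; last exact: dominated_integrable_prod.
congr fine; apply: eq_integral => y _.
by rewrite fineK//; apply: integrable_fin_num => //; exact: dominated_integrable_left.
Qed.

End DominatedFubini.

Section TensorIntegral.
Context d1 d2 (X : measurableType d1) (Y : measurableType d2) (R : realType).
Variables (mu : {sigma_finite_measure set X -> \bar R})
          (nu : {sigma_finite_measure set Y -> \bar R}).

Lemma Rintegral_tensor (a : X -> R) (b : Y -> R) :
  mu.-integrable setT (EFin \o a) -> nu.-integrable setT (EFin \o b) ->
  Rintegral (mu \x nu)%E setT (fun p => a p.1 * b p.2) =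
  Rintegral mu setT a * Rintegral nu setT b.
Proof.
move=> ia ib.
have mab : measurable_fun setT (fun p : X * Y => a p.1 * b p.2).
  by apply/measurable_EFinP; exact: measurable_int (integrable_tensor ia ib).
rewrite (dominated_Fubini_right (integrable_norm ia) (integrable_norm ib) mab)/=;
  last first.
  by move=> x y; rewrite normrM.
rewrite -RintegralZr//; apply: eq_Rintegral => x _; exact: RintegralZl.
Qed.

End TensorIntegral.

Section NonnegIntegral.
Context d (X : measurableType d) (R : realType) (mu : {measure set X -> \bar R}).

(* Unlike [ge0_le_integral], no measurability is required. *)
Lemma ge0_le_integralT (f g : X -> \bar R) : (forall x, 0 <= f x)%E ->
  (forall x, f x <= g x)%E -> (\int[mu]_x f x <= \int[mu]_x g x)%E.
Proof.
move=> f0 fg; have g0 x : (0 <= g x)%E by exact: le_trans (fg x).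
rewrite !ge0_integralTE//; apply: ereal_sup_le => _ [h hf <-].
by exists h => // x; exact: le_trans (fg x).
Qed.

End NonnegIntegral.

(** * Measurability of integrals with a parameter and of Caratheodory functions *)

Section ParameterIntegral.
Context d1 d2 (X : measurableType d1) (Y : measurableType d2) (R : realType).
Variable nu : {sigma_finite_measure set Y -> \bar R}.

(** [fine] is measurable, and the extended integral is the difference of the Tonelli integrals of
    the positive and negative parts of [K]. *)
Lemma measurable_Rintegral_param (K : X * Y -> R) : measurable_fun setT K ->
  measurable_fun setT (fun x => Rintegral nu setT (fun y => K (x, y))).
Proof.
move=> mK; apply: measurableT_comp; first exact: fine_measurable.
have mK' : measurable_fun setT (EFin \o K) by exact/measurable_EFinP.
rewrite (_ : (fun x => _) = (fun x => fubini_F nu ((EFin \o K)^\+)%E x -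
    fubini_F nu ((EFin \o K)^\-)%E x)%E); last first.
  by apply/funext => x; rewrite integralE; congr (_ - _)%E; apply: eq_integral => y _;
    rewrite ?funeposE ?funenegE.
apply: emeasurable_funB; apply: measurable_fun_fubini_tonelli_F => //.
  exact: measurable_funepos.
exact: measurable_funeneg.
Qed.

(* f(x, y) is the limit of f(x, q_n(y)) where q_n(y) ranges over a countable grid. *)
Lemma measurable_fun_Caratheodory (f : X * R -> R) :
  (forall y, measurable_fun setT (fun x => f (x, y))) ->
  (forall x, continuous (fun y => f (x, y))) -> measurable_fun setT f.
Proof.
move=> mf cf.
pose q (n : nat) (y : R) : int := Num.floor (y * n.+1%:R).
pose fn (n : nat) (p : X * R) := f (p.1, (q n p.2)%:~R / n.+1%:R).
have mfn n : measurable_fun setT (fn n).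
  move=> _ A mA; rewrite setTI.
  (* Since [q n] takes integer values, the preimage is a countable union of measurable rectangles,
     one for each value of [q n]. *)
  have -> : fn n @^-1` A = \bigcup_(k : int)
      [set p | A (f (p.1, k%:~R / n.+1%:R)) /\ q n p.2 = k].
    by apply/seteqP; split=> [p Ap|p [k _ [Ap qk]]];
      [exists (q n p.2)|rewrite /preimage/= /fn qk].
  apply: countable_bigcupT_measurable; first exact: countableP.
  move=> k.
  have -> : [set p : X * R | A (f (p.1, k%:~R / n.+1%:R)) /\ q n p.2 = k] =
    ((fun x => f (x, k%:~R / n.+1%:R)) @^-1` A) `*` (q n @^-1` [set k]).
    by apply/seteqP; split.
  apply: measurableX; first by rewrite -[X in measurable X]setTI; exact: mf.
  rewrite (_ : _ @^-1` _ = `[k%:~R / n.+1%:R, (k + 1)%:~R / n.+1%:R[%classic)//.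
  apply/seteqP; split=> y /=; rewrite in_itv/= ler_pdivrMr// ltr_pdivlMr//.
    by move=> <-; rewrite floor_itv.
  by move=> /floor_def.
apply: (measurable_fun_cvg mfn) => -[x y] _.
suff qy : (fun n => (q n y)%:~R / n.+1%:R : R) @ \oo --> y.
  exact: (cvg_comp _ _ qy (cf x y)).
apply/cvgrPdist_le => e e0; near=> n.
have n0 : 0 < n.+1%:R :> R by [].
have /andP[h1 h2] := floor_itv (y * n.+1%:R).
rewrite ger0_norm ?subr_ge0 ?ler_pdivrMr//.
apply: (@le_trans _ _ n.+1%:R^-1).
  rewrite lerBlDr -[X in X + _]mul1r -mulrDl ler_pdivlMr// addrC.
  by move: h2; rewrite intrD => /ltW.
apply: ltW; near: n; exact: (near_infty_natSinv_lt (PosNum e0)).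
Unshelve. all: by end_near. Qed.

End ParameterIntegral.

(** * Complex-valued functions: modulus, measurability, integration *)

Section ComplexNumbers.
Context {R : realType}.
Implicit Types (z w : R[i]) (a b : R).
Local Notation Re := complex.Re.
Local Notation Im := complex.Im.

Lemma complex_ext z w : Re z = Re w -> Im z = Im w -> z = w.
Proof. by case: z w => ? ? [? ?] /= -> ->. Qed.

Lemma cReM z w : Re (z * w) = Re z * Re w - Im z * Im w.
Proof. by case: z w => ? ? [? ?]. Qed.

Lemma cImM z w : Im (z * w) = Re z * Im w + Im z * Re w.
Proof. by case: z w => ? ? [? ?]. Qed.

Lemma cReD z w : Re (z + w) = Re z + Re w.
Proof. by case: z w => ? ? [? ?]. Qed.

Lemma cImD z w : Im (z + w) = Im z + Im w.
Proof. by case: z w => ? ? [? ?]. Qed.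

(* The l^1 norm of C = R^2, an equivalent of the modulus free of square roots. *)
Definition cabs1 z : R := `|Re z| + `|Im z|.

Lemma cabs1_ge0 z : 0 <= cabs1 z. Proof. exact: addr_ge0. Qed.

Lemma Re_le_cabs1 z : `|Re z| <= cabs1 z. Proof. by rewrite lerDl. Qed.

Lemma Im_le_cabs1 z : `|Im z| <= cabs1 z. Proof. by rewrite lerDr. Qed.

Lemma cabs1_real a : cabs1 a%:C = `|a|. Proof. by rewrite /cabs1/= normr0 addr0. Qed.

Lemma cabs1M z w : cabs1 (z * w) <= cabs1 z * cabs1 w.
Proof.
rewrite /cabs1 cReM cImM mulrDl !mulrDr -!normrM.
by apply: le_trans (lerD (ler_normB _ _) (ler_normD _ _)) _; lra.
Qed.

Lemma cabs1D z w : cabs1 (z + w) <= cabs1 z + cabs1 w.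
Proof. by rewrite /cabs1 cReD cImD addrACA lerD ?ler_normD. Qed.

Lemma cmodulus_le_cabs1 z : cmodulus z <= cabs1 z.
Proof.
case: z => a b; rewrite /cmodulus/= -[leRHS](ger0_norm (cabs1_ge0 _)) -sqrtr_sqr.
rewrite ler_wsqrtr// /cabs1/= sqrrD !real_normK ?num_real//.
by rewrite -addrA [_ *+ 2 + _]addrC addrA lerDl mulrn_wge0// mulr_ge0.
Qed.

Lemma Re_le_cmodulus z : `|Re z| <= cmodulus z.
Proof.
by case: z => a b; rewrite /cmodulus/= -sqrtr_sqr ler_wsqrtr// lerDl sqr_ge0.
Qed.

Lemma Im_le_cmodulus z : `|Im z| <= cmodulus z.
Proof.
by case: z => a b; rewrite /cmodulus/= -sqrtr_sqr ler_wsqrtr// lerDr sqr_ge0.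
Qed.

Lemma cabs1_le_cmodulus z : cabs1 z <= 2 * cmodulus z.
Proof. by rewrite mulrDl mul1r lerD// ?Re_le_cmodulus ?Im_le_cmodulus. Qed.

Lemma cmodulus_real a : cmodulus a%:C = `|a|.
Proof. by rewrite /cmodulus/= expr0n addr0 sqrtr_sqr. Qed.

Lemma expiD a b : expi (a + b) = expi a * expi b.
Proof. by apply: complex_ext; rewrite ?cReM ?cImM/= ?cosD ?sinD; ring. Qed.

(** A crude bound, by [1] for each of cosine and sine; it is the source of the constant [2] in the
    kernel estimates below. *)
Lemma cabs1_expi a : cabs1 (expi a) <= 2.
Proof. by rewrite -[leRHS]/(1 + 1); apply: lerD; [exact: cos_max|exact: sin_max]. Qed.

End ComplexNumbers.

Section ComplexMeasurable.
Context d d' (X : measurableType d) (Y : measurableType d') (R : realType).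
Implicit Types (f g : X -> R[i]).
Local Notation Re := complex.Re.
Local Notation Im := complex.Im.

Lemma cmeasurable_real (h : X -> R) :
  measurable_fun setT h -> cmeasurable (fun x => (h x)%:C).
Proof. by move=> mh; split. Qed.

Lemma cmeasurable_cst (a : R[i]) : cmeasurable (fun _ : X => a).
Proof. by split; exact: measurable_cst. Qed.

Lemma cmeasurableD f g : cmeasurable f -> cmeasurable g ->
  cmeasurable (fun x => f x + g x).
Proof.
move=> [mf1 mf2] [mg1 mg2]; split.
  by under eq_fun do rewrite cReD; exact: measurable_funD.
by under eq_fun do rewrite cImD; exact: measurable_funD.
Qed.

Lemma cmeasurableM f g : cmeasurable f -> cmeasurable g ->
  cmeasurable (fun x => f x * g x).
Proof.
move=> [mf1 mf2] [mg1 mg2]; split.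
  by under eq_fun do rewrite cReM; apply: measurable_funB; exact: measurable_funM.
by under eq_fun do rewrite cImM; apply: measurable_funD; exact: measurable_funM.
Qed.

Lemma cmeasurable_comp f (h : Y -> X) : cmeasurable f -> measurable_fun setT h ->
  cmeasurable (f \o h).
Proof.
by move=> [mf1 mf2] mh; split; [exact: (measurableT_comp mf1)|exact: (measurableT_comp
  mf2)].
Qed.

Lemma cmeasurable_expi (h : X -> R) :
  measurable_fun setT h -> cmeasurable (fun x => expi (h x)).
Proof.
move=> mh; split; (apply: measurableT_comp mh; apply: continuous_measurable_fun).
  exact: continuous_cos.
exact: continuous_sin.
Qed.

End ComplexMeasurable.

Section ComplexIntegral.
Context d (X : measurableType d) (R : realType) (mu : {measure set X -> \bar R}).
Implicit Types (f g : X -> R[i]).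
Local Notation Re := complex.Re.
Local Notation Im := complex.Im.

Lemma cintegrable_dominated f (h : X -> R) : cmeasurable f ->
  mu.-integrable setT (EFin \o h) -> (forall x, cabs1 (f x) <= h x) ->
  cintegrable mu f.
Proof.
move=> [mf1 mf2] ih fh; split.
  apply: (le_integrable measurableT _ _ ih); first exact/measurable_EFinP.
  move=> x _ /=; rewrite lee_fin (le_trans (Re_le_cabs1 _))// (le_trans (fh x))//.
  exact: ler_norm.
apply: (le_integrable measurableT _ _ ih); first exact/measurable_EFinP.
move=> x _ /=; rewrite lee_fin (le_trans (Im_le_cabs1 _))// (le_trans (fh x))//.
exact: ler_norm.
Qed.

Lemma cintegrable_measurable f : cintegrable mu f -> cmeasurable f.
Proof.
by move=> [/measurable_int ? /measurable_int ?]; split; exact/measurable_EFinP.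
Qed.

Lemma integrable_cabs1 f : cintegrable mu f ->
  mu.-integrable setT (EFin \o (fun x => cabs1 (f x))).
Proof.
move=> [i1 i2]; rewrite (_ : _ \o _ = (EFin \o (fun x =>
  `|Re (f x)|)%R) \+ (EFin \o (fun x => `|Im (f x)|)%R))%E//.
by apply: integrableD => //; exact: integrable_norm.
Qed.

Lemma cintegrableZr (a : R[i]) f : cintegrable mu f -> cintegrable mu (fun x => f x * a).
Proof.
move=> fi; apply: (cintegrable_dominated _ (integrableZr measurableT (cabs1 a)
  (integrable_cabs1 fi))).
  by apply: cmeasurableM; [exact: cintegrable_measurable|exact: cmeasurable_cst].
by move=> x; exact: cabs1M.
Qed.

Lemma cintegrableM_bounded f g (C : R) : cintegrable mu f -> cmeasurable g ->
  (forall x, cabs1 (g x) <= C) -> cintegrable mu (fun x => f x * g x).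
Proof.
move=> fi mg gC.
apply: (cintegrable_dominated _ (integrableZr measurableT C (integrable_cabs1 fi))).
  by apply: cmeasurableM => //; exact: cintegrable_measurable.
by move=> x; apply: le_trans (cabs1M _ _) _; rewrite ler_wpM2l ?cabs1_ge0.
Qed.

Lemma eq_cintegral f g : f =1 g -> cintegral mu f = cintegral mu g.
Proof. by move=> /funext ->. Qed.

Lemma cintegralD f g : cintegrable mu f -> cintegrable mu g ->
  cintegral mu (fun x => f x + g x) = cintegral mu f + cintegral mu g.
Proof.
move=> [f1 f2] [g1 g2]; apply: complex_ext; rewrite ?cReD ?cImD/= -RintegralD//.
  by apply: eq_Rintegral => x _; rewrite cReD.
by apply: eq_Rintegral => x _; rewrite cImD.
Qed.

Lemma cintegralZl (a : R[i]) f : cintegrable mu f ->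
  cintegral mu (fun x => a * f x) = a * cintegral mu f.
Proof.
move=> [f1 f2].
have iZ k (h : X -> R) : mu.-integrable setT (EFin \o h) ->
    mu.-integrable setT (EFin \o (fun x => k * h x)).
  by move=> ih; exact: (integrableZl measurableT k ih).
apply: complex_ext; rewrite ?cReM ?cImM/= -!RintegralZl//.
  rewrite -RintegralB//; try exact: iZ.
  by apply: eq_Rintegral => x _; rewrite cReM.
rewrite -RintegralD//; try exact: iZ.
by apply: eq_Rintegral => x _; rewrite cImM.
Qed.

Lemma cintegralZr (a : R[i]) f : cintegrable mu f ->
  cintegral mu (fun x => f x * a) = cintegral mu f * a.
Proof.
move=> fi; rewrite mulrC -cintegralZl//.
by apply: eq_cintegral => x; rewrite mulrC.
Qed.

Lemma cabs1_cintegral f : cintegrable mu f ->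
  cabs1 (cintegral mu f) <= Rintegral mu setT (fun x => cabs1 (f x)).
Proof.
move=> [f1 f2]; rewrite /cabs1 RintegralD//; [|exact: integrable_norm..].
by apply: lerD; exact: le_normr_Rintegral.
Qed.

Lemma cabs1_cintegral_le f (h : X -> R) : cmeasurable f ->
  mu.-integrable setT (EFin \o h) -> (forall x, cabs1 (f x) <= h x) ->
  cabs1 (cintegral mu f) <= Rintegral mu setT h.
Proof.
move=> mf ih fh; have fi := cintegrable_dominated mf ih fh.
apply: (le_trans (cabs1_cintegral fi)); apply: le_Rintegral => //.
exact: integrable_cabs1.
Qed.

End ComplexIntegral.

(** * Fubini for complex kernels and the exchange of a kernel between two functions *)

Section ComplexFubini.
Context d1 d2 (X : measurableType d1) (Y : measurableType d2) (R : realType).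
Variables (mu : {sigma_finite_measure set X -> \bar R})
          (nu : {sigma_finite_measure set Y -> \bar R}).
Local Notation Re := complex.Re.
Local Notation Im := complex.Im.

Lemma cmeasurable_cintegral_param (K : X * Y -> R[i]) : cmeasurable K ->
  cmeasurable (fun x => cintegral nu (fun y => K (x, y))).
Proof. by move=> [m1 m2]; split;
  [exact: (measurable_Rintegral_param nu m1)|exact: (measurable_Rintegral_param nu m2)].
    Qed.

Section Dominated.
Variables (a : X -> R) (b : Y -> R).
Hypothesis ia : mu.-integrable setT (EFin \o a).
Hypothesis ib : nu.-integrable setT (EFin \o b).
Variable K : X * Y -> R[i].
Hypothesis mK : cmeasurable K.
Hypothesis Kab : forall x y, cabs1 (K (x, y)) <= a x * b y.

Let ReK x y : `|Re (K (x, y))| <= a x * b y.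
Proof. exact: le_trans (Re_le_cabs1 _) _. Qed.

Let ImK x y : `|Im (K (x, y))| <= a x * b y.
Proof. exact: le_trans (Im_le_cabs1 _) _. Qed.

Lemma dominated_cintegrable_prod : cintegrable (mu \x nu)%E K.
Proof.
by split; [exact: (dominated_integrable_prod ia ib mK.1 ReK)|exact:
  (dominated_integrable_prod ia ib mK.2 ImK)].
Qed.

Lemma dominated_cFubini_right : cintegral (mu \x nu)%E K =
  cintegral mu (fun x => cintegral nu (fun y => K (x, y))).
Proof.
by congr Complex; [exact: (dominated_Fubini_right ia ib mK.1 ReK)|exact:
  (dominated_Fubini_right ia ib mK.2 ImK)].
Qed.

Lemma dominated_cFubini_left : cintegral (mu \x nu)%E K =
  cintegral nu (fun y => cintegral mu (fun x => K (x, y))).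
Proof.
by congr Complex; [exact: (dominated_Fubini_left ia ib mK.1 ReK)|exact:
  (dominated_Fubini_left ia ib mK.2 ImK)].
Qed.

End Dominated.

Section Tensor.
Variables (f : X -> R[i]) (g : Y -> R[i]).
Hypotheses (fi : cintegrable mu f) (gi : cintegrable nu g).

Lemma cmeasurable_tensor : cmeasurable (fun p : X * Y => f p.1 * g p.2).
Proof.
apply: cmeasurableM.
  by apply: (cmeasurable_comp (cintegrable_measurable fi)).
by apply: (cmeasurable_comp (cintegrable_measurable gi)).
Qed.

Lemma cintegrable_tensor : cintegrable (mu \x nu)%E (fun p => f p.1 * g p.2).
Proof.
apply: (dominated_cintegrable_prod (integrable_cabs1 fi) (integrable_cabs1 gi)) => *.
  exact: cmeasurable_tensor.
exact: cabs1M.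
Qed.

Lemma cintegral_tensor : cintegral (mu \x nu)%E (fun p => f p.1 * g p.2) =
  cintegral mu f * cintegral nu g.
Proof.
rewrite (dominated_cFubini_right (integrable_cabs1 fi) (integrable_cabs1 gi))/=.
- by under eq_cintegral do rewrite cintegralZl//; rewrite cintegralZr.
- exact: cmeasurable_tensor.
- by move=> *; exact: cabs1M.
Qed.

End Tensor.

(** Both sides are iterated integrals of [f x * k (x, y) * g y], which is dominated by
    [cabs1 (f x) * C * cabs1 (g y)]. When [k] is a character this is the multiplication formula for
    the Fourier transform. *)
Lemma cintegral_kernel_swap (f : X -> R[i]) (g : Y -> R[i]) (k : X * Y -> R[i]) (C : R) :
  cintegrable mu f -> cintegrable nu g -> cmeasurable k ->
  (forall p, cabs1 (k p) <= C) ->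
  cintegral mu (fun x => f x * cintegral nu (fun y => g y * k (x, y))) =
  cintegral nu (fun y => cintegral mu (fun x => f x * k (x, y)) * g y).
Proof.
move=> fi gi mk kC.
have mf := cintegrable_measurable fi; have mg := cintegrable_measurable gi.
have i1 := integrableZr measurableT C (integrable_cabs1 fi).
have i2 := integrable_cabs1 gi.
have bnd (K : X * Y -> R[i]) : K = (fun p => f p.1 * k p * g p.2) ->
    forall x y, cabs1 (K (x, y)) <= cabs1 (f x) * C * cabs1 (g y).
  move=> -> x y; apply: le_trans (cabs1M _ _) _.
  apply: ler_wpM2r; first exact: cabs1_ge0.
  apply: le_trans (cabs1M _ _) _.
  by apply: ler_wpM2l; [exact: cabs1_ge0|exact: kC].
have mK : cmeasurable (fun p : X * Y => f p.1 * k p * g p.2).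
  apply: cmeasurableM; first apply: cmeasurableM => //.
    exact: (cmeasurable_comp mf).
  exact: (cmeasurable_comp mg).
have gki x : cintegrable nu (fun y => g y * k (x, y)).
  apply: (cintegrable_dominated (h := fun y => cabs1 (g y) * C)).
  - by apply: cmeasurableM => //; exact: (cmeasurable_comp mk (pair1_measurable x)).
  - exact: (integrableZr measurableT C (integrable_cabs1 gi)).
  - move=> y; apply: le_trans (cabs1M _ _) _.
    by apply: ler_wpM2l; [exact: cabs1_ge0|exact: kC].
have fki y : cintegrable mu (fun x => f x * k (x, y)).
  apply: (cintegrable_dominated (h := fun x => cabs1 (f x) * C)) => //.
  - by apply: cmeasurableM => //; exact: (cmeasurable_comp mk (pair2_measurable y)).
  - move=> x; apply: le_trans (cabs1M _ _) _.
    by apply: ler_wpM2l; [exact: cabs1_ge0|exact: kC].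
transitivity (cintegral (mu \x nu)%E (fun p => f p.1 * k p * g p.2)).
  rewrite (dominated_cFubini_right i1 i2 mK (bnd _ erefl))/=.
  apply: eq_cintegral => x; rewrite -cintegralZl//.
  by apply: eq_cintegral => y; rewrite -mulrA [k _ * _]mulrC.
rewrite (dominated_cFubini_left i1 i2 mK (bnd _ erefl))/=.
by apply: eq_cintegral => x; rewrite -cintegralZr.
Qed.

End ComplexFubini.

(** * Integrals over the real line by primitives *)

Section LineIntegrals.
Context {R : realType}.
Implicit Types (f F : R -> R).
Local Notation leb := (@lebesgue_measure R).

Lemma is_derive_continuous f F : (forall x : R, is_derive x 1 F (f x)) -> continuous F.
Proof.
by move=> dF x; apply/differentiable_continuous/derivable1_diffP; exact: ex_derive.
Qed.

Lemma Rintegral_FTC f F (a b : R) : a < b -> continuous f -> continuous F ->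
  (forall x, a < x < b -> is_derive x 1 F (f x)) ->
  Rintegral leb `[a, b] f = F b - F a.
Proof.
move=> ab cf cF dF; rewrite /Rintegral (@continuous_FTC2 _ _ F)//.
- exact: continuous_subspaceT.
- split.
  + by move=> x; rewrite in_itv => /dF dFx; exact: ex_derive.
  + exact/cvg_at_right_filter/cF.
  + exact/cvg_at_left_filter/cF.
- by move=> x; rewrite in_itv => /dF dFx; rewrite derive1E derive_val.
Qed.

(** Dominated convergence for the truncations of [f], with majorant [|f|]; at a fixed point the
    truncations are eventually constant. *)
Lemma cvg_Rintegral_itv f : leb.-integrable setT (EFin \o f) ->
  (fun n => Rintegral leb `[- n.+1%:R, n.+1%:R] f) @ \oo --> Rintegral leb setT f.
Proof.
move=> fi; have mf := measurable_int leb fi.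
pose fn n := (EFin \o f) \_ (`[- n.+1%:R, n.+1%:R] : set R).
have mfn n : measurable_fun setT (fn n).
  by apply/(measurable_restrictT _ _).1 => //; exact: measurable_funTS.
have fnf : {ae leb, forall x, setT x -> fn ^~ x @ \oo --> (EFin \o f) x}.
  apply: aeW => x _; apply: cvg_near_cst; near=> n.
  rewrite /fn patchE mem_set//= in_itv/= -ler_norml.
  by apply: (@le_trans _ _ n%:R); [near: n; exact: nbhs_infty_ger|rewrite ler_nat].
have fng : {ae leb, forall x n, setT x -> (`|fn n x| <= (abse \o (EFin \o f)) x)%E}.
  by apply: aeW => x n _; rewrite /fn patchE; case: ifP => /= _ ; rewrite lee_fin ?normr0.
have [_ _ h] := @dominated_convergence _ _ _ leb _ measurableT _ _ _ mfn mf fnf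
  (integrable_abse fi) fng.
rewrite /Rintegral.
apply: fine_cvg; rewrite fineK; last exact: integrable_fin_num.
apply: cvg_trans h; apply: near_eq_cvg; near=> n.
by rewrite [in RHS]integral_mkcond.
Unshelve. all: by end_near. Qed.

(** Each half-line has its own primitive, continuous up to [0] but differentiated only away from it.
    This accommodates integrands containing [e^(-a|x|)], whose primitive changes form at the
    origin. *)
Lemma Rintegral_line f (Fp Fm : R -> R) (lp lm : R) : continuous f ->
  leb.-integrable setT (EFin \o f) -> continuous Fp -> continuous Fm ->
  (forall x : R, 0 < x -> is_derive x 1 Fp (f x)) ->
  (forall x : R, x < 0 -> is_derive x 1 Fm (f x)) ->
  (fun n => Fp n.+1%:R) @ \oo --> lp -> (fun n => Fm (- n.+1%:R)) @ \oo --> lm ->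
  Rintegral leb setT f = lp - Fp 0 + (Fm 0 - lm).
Proof.
move=> cf fi cFp cFm dFp dFm Fplp Fmlm.
have fiS A : measurable A -> leb.-integrable A (EFin \o f).
  by move=> mA; apply: integrableS fi.
apply: (cvg_unique _ (cvg_Rintegral_itv fi)) => //.
rewrite (_ : (fun n => _) = fun n => Fp n.+1%:R - Fp 0 + (Fm 0 - Fm (- n.+1%:R))).
  by apply: cvgD; apply: cvgB => //; exact: cvg_cst.
apply/funext => n.
have n0 : 0 < n.+1%:R :> R by [].
have n0' : - n.+1%:R < 0 :> R by rewrite oppr_lt0.
have <- := Rintegral_FTC n0 cf cFp (fun x h => dFp x (proj1 (andP h))).
have <- := Rintegral_FTC n0' cf cFm (fun x h => dFm x (proj2 (andP h))).
rewrite -Rintegral_itv_obnd_cbnd; last exact: fiS.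
rewrite -(@Rintegral_itvB _ f (BLeft (- n.+1%:R)) (BRight n.+1%:R) 0)/=.
- by rewrite subrK.
- exact: fiS.
- by rewrite bnd_simp ltW.
- by rewrite bnd_simp ltW.
Qed.

(** By evenness, the known integral over the positive half-line suffices. This function is the
    majorant for the one-variable integrals below. *)
Lemma integrable_oneDsqrV :
  leb.-integrable setT (EFin \o (fun x : R => (oneDsqr x)^-1)).
Proof.
have c : continuous (fun x : R => (oneDsqr x)^-1) by exact: continuous_oneDsqrV.
apply/integrableP; split.
  by apply/measurable_EFinP; exact: continuous_measurable_fun.
under eq_integral do rewrite /= ger0_norm ?invr_ge0//.
rewrite ge0_symfun_integralT//.
- by rewrite -set_itvcy integral0y_oneDsqr -EFinM ltry.
- by move=> x; rewrite /oneDsqr/= sqrrN.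
Qed.

(** Differentiation preserves the span of [e^(kx) sin(x xi)] and [e^(kx) cos(x xi)], acting linearly
    on the coefficients [(p, q)]. Inverting this linear map produces primitives. *)
Lemma is_derive_damped (k xi p q x : R) :
  is_derive x 1 (fun x => expR (k * x) * (p * sin (x * xi) + q * cos (x * xi)))
   (expR (k * x) * ((k * p - xi * q) * sin (x * xi) + (k * q + xi * p) * cos (x * xi))).
Proof.
have d1 : is_derive x 1 (fun x => k * x) k by apply: is_derive_eq;
  rewrite /GRing.scale/=; ring.
have d2 : is_derive x 1 (fun x => x * xi) xi by apply: is_derive_eq;
  rewrite /GRing.scale/=; ring.
have e1 : is_derive x 1 (fun x => expR (k * x)) (expR (k * x) * k).
  by apply: is_derive_eq; rewrite /GRing.scale/=; ring.
have e2 : is_derive x 1 (fun x => sin (x * xi)) (cos (x * xi) * xi).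
  by apply: is_derive_eq; rewrite /GRing.scale/=; ring.
have e3 : is_derive x 1 (fun x => cos (x * xi)) (- sin (x * xi) * xi).
  by apply: is_derive_eq; rewrite /GRing.scale/=; ring.
by apply: is_derive_eq; rewrite /GRing.scale/=; ring.
Qed.

Lemma cvg0_le_oneDsqrV (u : nat -> R) (C : R) :
  (forall n, `|u n| <= C * (oneDsqr (n.+1%:R : R))^-1) -> u @ \oo --> (0 : R).
Proof.
move=> uC; apply/norm_cvg0P.
have C0 : 0 <= C.
  rewrite -(@pmulr_lge0 _ (oneDsqr (1%:R : R))^-1) ?invr_gt0//.
  exact: le_trans (uC 0%N).
(* [harmonic n] is [1/(n+1)], and [1 + m^2 >= m] for [m = n + 1]. *)
apply: (@squeeze_cvgr _ _ _ _ (fun=> 0) (fun n => C * harmonic n)).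
- apply: nearW => n; rewrite normr_ge0/= (le_trans (uC n))// ler_wpM2l//.
  rewrite lef_pV2 ?posrE// /oneDsqr; have : 1 <= n.+1%:R :> R by rewrite ler1n.
  nra.
- exact: cvg_cst.
- have := cvgM (@cvg_cst _ C _ _ _) (@cvg_harmonic R); rewrite mulr0; exact.
Qed.

End LineIntegrals.

(** * The Poisson kernel as the Fourier transform of [e^(-a|x|)] *)

Section PoissonKernel.
Context {R : realType}.
Local Notation leb := (@lebesgue_measure R).
Implicit Types a x xi M : R.

Definition pkernel a x : R := 2 * a / (a ^+ 2 + x ^+ 2).

Lemma sqrD_gt0 a x : 0 < a -> 0 < a ^+ 2 + x ^+ 2.
Proof. by move=> a0; rewrite ltr_pwDl ?sqr_ge0// exprn_gt0. Qed.

Lemma pkernel_ge0 a x : 0 <= a -> 0 <= pkernel a x.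
Proof. by move=> a0; rewrite /pkernel divr_ge0 ?mulr_ge0// addr_ge0 ?sqr_ge0. Qed.

Lemma pkernel_le a x : 1 <= a -> pkernel a x <= 2 * a * (oneDsqr x)^-1.
Proof.
move=> a1; have a0 : 0 < a by apply: lt_le_trans a1.
rewrite /pkernel ler_pM2l ?mulr_gt0//.
by rewrite lef_pV2 ?posrE ?sqrD_gt0// lerD2r expr_ge1// ltW.
Qed.

Lemma continuous_pkernel a : 0 < a -> continuous (pkernel a).
Proof.
move=> a0 x; apply: cvgM; first exact: cvg_cst.
apply: cvgV; first by rewrite gt_eqF// sqrD_gt0.
by apply: cvgD; [exact: cvg_cst|exact: exprn_continuous].
Qed.

Lemma integrable_pkernel a : 1 <= a -> leb.-integrable setT (EFin \o pkernel a).
Proof.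
move=> a1; have a0 : 0 < a by apply: lt_le_trans a1.
apply: (le_integrable measurableT _ _ (integrableZl measurableT (2 * a)
  integrable_oneDsqrV)).
  by apply/measurable_EFinP; apply: continuous_measurable_fun; exact: continuous_pkernel.
move=> x _ /=; rewrite lee_fin ger0_norm ?pkernel_ge0 ?(ltW a0)//.
by rewrite (le_trans (pkernel_le _ a1))// ler_norm.
Qed.

Lemma is_derive_pkernel a x : 0 < a ->
  is_derive x 1 (fun x => 2 * atan (x / a)) (pkernel a x).
Proof.
move=> a0.
have d : is_derive x 1 (fun x => x / a) a^-1.
  by apply: is_derive_eq; rewrite /GRing.scale/=; ring.
have e : is_derive x 1 (fun x => atan (x / a)) ((1 + (x / a) ^+ 2)^-1 * a^-1).
  by apply: is_derive1_comp.
apply: is_derive_eq; rewrite /GRing.scale/= /pkernel.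
have h : a ^+ 2 + x ^+ 2 != 0 by rewrite gt_eqF// sqrD_gt0.
have h2 : 1 + (x / a) ^+ 2 != 0 by rewrite gt_eqF// ltr_pwDl ?sqr_ge0.
by field; rewrite ?h ?gt_eqF.
Qed.

Lemma continuous_atan_div a : 0 < a -> continuous (fun x : R => 2 * atan (x / a)).
Proof. by move=> a0; apply: is_derive_continuous => x; exact: is_derive_pkernel. Qed.

(** The primitive [2 atan(x/a)] depends on [x/a] only, so the mass of an interval scaled by [a] does
    not depend on [a]. This is the uniformity in [L] behind the lower bound. *)
Lemma Rintegral_pkernel_itv a M : 0 < a -> 0 < M ->
  Rintegral leb `[- (M * a), M * a] (pkernel a) = 4 * atan M.
Proof.
move=> a0 M0; have Ma : 0 < M * a by rewrite mulr_gt0.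
have NMa : - (M * a) < M * a by rewrite gtrN.
rewrite (Rintegral_FTC NMa (continuous_pkernel a0) (continuous_atan_div a0)
  (fun x _ => is_derive_pkernel x a0)).
by rewrite mulNr mulfK ?gt_eqF// atanN; ring.
Qed.

Lemma Rintegral_pkernel a : 1 <= a -> Rintegral leb setT (pkernel a) = 2 * pi.
Proof.
move=> a1; have a0 : 0 < a by apply: lt_le_trans a1.
have lim : (fun n => 2 * atan (n.+1%:R / a)) @ \oo --> (pi : R).
  have h : (fun n => atan (n.+1%:R / a)) @ \oo --> (pi / 2 : R).
    have h1 : (fun n => n.+1%:R : R) @ \oo --> +oo by rewrite (cvg_shiftS (fun n =>
      n%:R : R)); exact: cvgr_idn.
    have h2 : (r / a) @[r --> (+oo : set_system R)] --> +oo by apply: gt0_cvgMly;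
      [rewrite invr_gt0|exact: cvg_id].
    exact: cvg_comp (cvg_comp _ _ h1 h2) (@cvgy_atan R).
  have : (fun n => 2 * atan (n.+1%:R / a)) @ \oo --> (2 * (pi / 2) : R).
    by apply: (cvgM _ h); exact: cvg_cst.
  by rewrite mulrC divfK.
have lim' : (fun n => 2 * atan (- n.+1%:R / a)) @ \oo --> (- pi : R).
  rewrite (_ : (fun n => _) = (fun n => - (2 * atan (n.+1%:R / a)))); first exact: cvgN.
  by apply/funext => n; rewrite mulNr atanN mulrN.
rewrite (Rintegral_line (continuous_pkernel a0) (integrable_pkernel a1)
  (continuous_atan_div a0) (continuous_atan_div a0)
  (fun x _ => is_derive_pkernel x a0) (fun x _ => is_derive_pkernel x a0) lim lim').
by rewrite mul0r atan0; ring.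
Qed.

(** Squaring [e^u >= 1 + u] at [u = |x|/2] gives [e^|x| >= (1 + |x|/2)^2 >= (1 + x^2)/4]. *)
Lemma expR_abs_le a x : 1 <= a -> expR (- (a * `|x|)) <= 4 * (oneDsqr x)^-1.
Proof.
move=> a1; rewrite expRN -[4]invrK -invfM lef_pV2 ?posrE ?mulr_gt0 ?expR_gt0 ?invr_gt0//.
apply: (@le_trans _ _ (expR `|x|)); last first.
  by rewrite ler_expR ler_peMl.
have e : expR `|x| = expR (`|x| / 2)
  ^+ 2 by rewrite -expRM_natl -[_ *+ _]mulr_natl mulrC divfK.
rewrite e /oneDsqr -(real_normK (num_real x)).
have := expR_ge1Dx (`|x| / 2); have := normr_ge0 x; nra.
Qed.

Lemma damped_le a xi p q k x : 1 <= a -> k * x = - (a * `|x|) ->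
  `|expR (k * x) * (p * sin (x * xi) + q * cos (x * xi))| <=
  4 * (`|p| + `|q|) * (oneDsqr x)^-1.
Proof.
move=> a1 ->; rewrite normrM ger0_norm ?expR_ge0// [leRHS]mulrAC.
apply: ler_pM; rewrite ?expR_ge0// ?expR_abs_le//.
apply: le_trans (ler_normD _ _) _; rewrite !normrM lerD// ler_piMr//.
  exact: sin_max.
exact: cos_max.
Qed.

(** [D p q k] is the factor found in [is_derive_damped], so damped combinations are primitives on
    both half-lines. They vanish at infinity and take the values [q] and [q'] at [0]. *)
Lemma Rintegral_damped a xi p q p' q' (h : R -> R) : 1 <= a ->
  let D p q k x := (k * p - xi * q) * sin (x * xi) + (k * q + xi * p) * cos (x * xi) in
  continuous h ->
  (forall x, 0 < x -> h x = D p q (- a) x) -> (forall x, x < 0 -> h x = D p' q' a x) ->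
  (forall x, `|h x| <= 1) ->
  Rintegral leb setT (fun x => expR (- (a * `|x|)) * h x) = q' - q.
Proof.
move=> a1 D ch hp hm h1.
have cE : continuous (fun x : R => expR (- (a * `|x|)) : R).
  move=> x; apply: (cvg_comp _ (@expR R)); last exact: continuous_expR.
  by apply: cvgN; apply: cvgM; [exact: cvg_cst|exact: norm_continuous].
have cf : continuous (fun x : R => expR (- (a * `|x|)) * h x).
  by move=> x; apply: cvgM; [exact: cE|exact: ch].
have fi : leb.-integrable setT (EFin \o (fun x : R => expR (- (a * `|x|)) * h x)).
  apply: (le_integrable measurableT _ _ (integrableZl measurableT 4 integrable_oneDsqrV)).
    by apply/measurable_EFinP; exact: continuous_measurable_fun.
  move=> x _ /=; rewrite lee_fin [leRHS]ger0_norm ?mulr_ge0 ?invr_ge0//.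
  rewrite normrM ger0_norm ?expR_ge0// (le_trans _ (expR_abs_le x a1))// ler_piMr//.
pose F p q k (x : R) := expR (k * x) * (p * sin (x * xi) + q * cos (x * xi)).
have dF p0 q0 k x : is_derive x 1 (F p0 q0 k) (expR (k * x) * D p0 q0 k x).
  exact: is_derive_damped.
have dFp x : 0 < x -> is_derive x 1 (F p q (- a)) (expR (- (a * `|x|)) * h x).
  by move=> x0; rewrite hp// gtr0_norm// -mulNr; exact: dF.
have dFm x : x < 0 -> is_derive x 1 (F p' q' a) (expR (- (a * `|x|)) * h x).
  by move=> x0; rewrite hm// ltr0_norm// mulrN opprK; exact: dF.
have lp : (fun n => F p q (- a) n.+1%:R) @ \oo --> (0 : R).
  apply: (@cvg0_le_oneDsqrV _ _ (4 * (`|p| + `|q|))) => n.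
  by apply: (damped_le _ _ _ a1); rewrite ger0_norm// mulNr.
have lm : (fun n => F p' q' a (- n.+1%:R)) @ \oo --> (0 : R).
  apply: (@cvg0_le_oneDsqrV _ _ (4 * (`|p'| + `|q'|))) => n.
  have -> : oneDsqr (n.+1%:R : R) = oneDsqr (- n.+1%:R) by rewrite /oneDsqr sqrrN.
  by apply: (damped_le _ _ _ a1); rewrite normrN ger0_norm// mulrN.
rewrite (Rintegral_line cf fi (is_derive_continuous (dF _ _ _))
  (is_derive_continuous (dF _ _ _)) dFp dFm lp lm).
by rewrite /F !mulr0 !mul0r expR0 sin0 cos0; ring.
Qed.

Lemma fourier_expR_abs a xi : 1 <= a ->
  cintegral leb (fun x => (expR (- (a * `|x|)))%:C * expi (- (x * xi))) =
  (pkernel a xi)%:C.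
Proof.
move=> a1; have a0 : 0 < a by apply: lt_le_trans a1.
have D0 : a ^+ 2 + xi ^+ 2 != 0 by rewrite gt_eqF// sqrD_gt0.
have cid : continuous (fun x : R => x * xi).
  by move=> x; apply: cvgM; [exact: cvg_id|exact: cvg_cst].
set d := (a ^+ 2 + xi ^+ 2)^-1.
apply: complex_ext => /=.
  rewrite (@eq_Rintegral _ _ _ leb _ (fun x => expR (- (a * `|x|)) * cos (x * xi)));
    last first.
    by move=> x _; rewrite /= mul0r subr0 cosN.
  (* The coefficients solve [k p - xi q = 0] and [k q + xi p = 1], with [k = -a] on the right
     half-line and [k = a] on the left. *)
  rewrite (@Rintegral_damped a xi (xi * d) (- a * d) (xi * d) (a * d))//.
  - by rewrite /pkernel -/d; ring.
  - by move=> x; apply: (cvg_comp _ _ (cid x)); exact: continuous_cos.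
  - by move=> x _; rewrite /d; field.
  - by move=> x _; rewrite /d; field.
  - by move=> x; exact: cos_max.
rewrite (@eq_Rintegral _ _ _ leb _ (fun x => expR (- (a * `|x|)) * - sin (x * xi)));
  last first.
  by move=> x _; rewrite /= mul0r addr0 sinN.
(* Now the system is [k p - xi q = -1], [k q + xi p = 0]. Both solutions have [q = xi * d], so the
   imaginary part cancels. *)
rewrite (@Rintegral_damped a xi (a * d) (xi * d) (- a * d) (xi * d))//.
- by rewrite subrr.
- by move=> x; apply: cvgN; apply: (cvg_comp _ _ (cid x)); exact: continuous_sin.
- by move=> x _; rewrite /d; field.
- by move=> x _; rewrite /d; field.
- by move=> x; rewrite normrN; exact: sin_max.
Qed.

End PoissonKernel.

(** * Sigma-finite products and coordinates on [R^3] *)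

Section SigmaFinite.
Context d1 d2 (X : measurableType d1) (Y : measurableType d2) (R : realType).
Variables (mu : {sigma_finite_measure set X -> \bar R})
          (nu : {sigma_finite_measure set Y -> \bar R}).

(** Rectangles built from two nondecreasing exhaustions: monotonicity places a point in the
    rectangle whose index is the larger of the two. *)
Lemma sigma_finite_prod : sigma_finite setT (mu \x nu)%E.
Proof.
have /sigma_finiteP[F [FT ndF Ffin]] := sigma_finiteT mu.
have /sigma_finiteP[G [GT ndG Gfin]] := sigma_finiteT nu.
exists (fun n => F n `*` G n) => [|n].
  apply/seteqP; split => // -[x y] _.
  have : (\bigcup_n F n) x by rewrite -FT.
  have : (\bigcup_n G n) y by rewrite -GT.
  move=> [m _ Gmy] [k _ Fkx]; exists (maxn k m) => //; split.
    by have /subsetPset := ndF _ _ (leq_maxl k m); exact.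
  by have /subsetPset := ndG _ _ (leq_maxr k m); exact.
have [mFn Fn] := Ffin n; have [mGn Gn] := Gfin n.
by split; [exact: measurableX|rewrite product_measure1E// lte_mul_pinfty// ge0_fin_numE].
Qed.

End SigmaFinite.

Section Coordinates.
Context {R : realType}.
Local Notation leb := (@lebesgue_measure R).

(* The library's sigma-finiteness instance on products is only found by unification for
   subprobabilities, so that [leb2] and [leb3] need their own. *)
HB.instance Definition _ := Measure.copy (@leb2 R) (leb \x leb)%E.
HB.instance Definition _ := Measure_isSigmaFinite.Build _ _ _ (@leb2 R)
  (sigma_finite_prod leb leb).
HB.instance Definition _ := Measure.copy (@leb3 R) (leb2 \x leb)%E.
HB.instance Definition _ := Measure_isSigmaFinite.Build _ _ _ (@leb3 R)
  (sigma_finite_prod leb2 leb).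

Implicit Types (p q xi : R * R * R) (j : 'I_3) (t : R).

(** A tensor product rather than a power of [bracket2], so that integrability and Fubini reduce to
    one variable at a time. *)
Definition weight3 p : R := (oneDsqr p.1.1)^-1 * (oneDsqr p.1.2)^-1 * (oneDsqr p.2)^-1.

Lemma weight3_gt0 p : 0 < weight3 p.
Proof. by rewrite /weight3 !mulr_gt0 ?invr_gt0. Qed.

Lemma integrable_weight3 : leb3.-integrable setT (EFin \o weight3).
Proof.
have i1 := @integrable_oneDsqrV R.
have i2 : leb2.-integrable setT _ := integrable_tensor i1 i1.
exact: (integrable_tensor i2 i1).
Qed.

Lemma bracket2_ge1 p : 1 <= bracket2 p.
Proof. by rewrite /bracket2 lerDl /dot3 -!expr2 !addr_ge0 ?sqr_ge0. Qed.

(** Each [1 + x_j^2] is at most [bracket2 p]. Hence a bound on [bracket2 ^+ 3] times a function, as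
    in the seminorm of order [3], yields a bound by [weight3]. *)
Lemma bracket2_weight3 p : 1 <= bracket2 p ^+ 3 * weight3 p.
Proof.
rewrite /weight3 -!invfM ler_pdivlMr ?mulr_gt0// mul1r.
have b (x : R) : x \in [:: p.1.1; p.1.2; p.2] -> oneDsqr x <= bracket2 p.
  by rewrite /oneDsqr /bracket2 /dot3 !inE => /or3P[] /eqP ->; nra.
have o (x : R) : 0 <= oneDsqr x by [].
rewrite 2!exprS expr1 mulrA.
apply: ler_pM; rewrite ?mulr_ge0 ?b ?inE ?eqxx ?orbT//.
by apply: ler_pM; rewrite ?b ?inE ?eqxx ?orbT.
Qed.

Lemma dot3C p q : dot3 p q = dot3 q p.
Proof. by rewrite /dot3; ring. Qed.

Lemma measurable_dot3 : measurable_fun setT (fun r : (R * R * R) * (R * R * R) =>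
  dot3 r.1 r.2).
Proof.
by rewrite /dot3; apply: measurable_funD; [apply: measurable_funD|]; apply: measurable_funM;
  do ![exact: measurableT_comp|apply: measurableT_comp => //].
Qed.

(** As [t] varies, this runs over the line through [p] parallel to the [j]-th axis, where
    one-variable calculus applies. *)
Definition upd j p t : R * R * R :=
  ((if j == 0 :> nat then t else p.1.1, if j == 1 :> nat then t else p.1.2),
   if j == 2 :> nat then t else p.2).

Definition crd j p : R :=
  if j == 0 :> nat then p.1.1 else if j == 1 :> nat then p.1.2 else p.2.

Lemma upd_crd j p : upd j p (crd j p) = p.
Proof. by case: p => -[x y] z; case: j => -[|[|[|//]]]. Qed.

Lemma upd_shift j p t h : h *: basis3 j + upd j p t = upd j p (h *: 1 + t) .
Proof.
rewrite -[LHS]/((h * (j == 0 :> nat)%:R + (upd j p t).1.1,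
  h * (j == 1 :> nat)%:R + (upd j p t).1.2), h * (j == 2 :> nat)%:R + (upd j p t).2).
by rewrite /upd /GRing.scale/=; case: j => -[|[|[|//]]] ? /=; rewrite ?mulr1 ?mulr0 ?add0r.
Qed.

Lemma dot3_upd j p t xi : dot3 (upd j p t) xi = t * crd j xi + dot3 (upd j p 0) xi.
Proof. by rewrite /dot3 /upd /crd; case: j => -[|[|[|//]]] ? /=; ring. Qed.

Lemma weight3_upd j p t : weight3 (upd j p t) <= (oneDsqr t)^-1.
Proof.
have le1 (x : R) : (oneDsqr x)^-1 <= 1 by exact: oneDsqrV_le1.
have ge0 (x : R) : 0 <= (oneDsqr x)^-1 by rewrite invr_ge0.
rewrite /weight3 /upd; case: j => -[|[|[|//]]] ? /=.
- by rewrite -mulrA ler_piMr// mulr_ile1.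
- by rewrite mulrAC ler_piMl// mulr_ile1.
- by rewrite ler_piMl// mulr_ile1.
Qed.

Lemma weight3_le1 p : weight3 p <= 1.
Proof.
rewrite -(upd_crd (@Ordinal 3 0 isT) p); apply: le_trans (weight3_upd _ _ _) _.
exact: oneDsqrV_le1.
Qed.

(** By [upd_shift], the difference quotient on the line and the one along [basis3 j] are the same
    function of [h]. *)
Lemma derivable_upd (f : R * R * R -> R) j p t : derivable f (upd j p t) (basis3 j) ->
  is_derive t 1 (fun s => f (upd j p s)) ('D_(basis3 j) f (upd j p t)).
Proof.
have E : (fun h : R => h^-1 *: (((fun s =>
  f (upd j p s)) \o shift t) (h *: 1) - f (upd j p t))) =
  (fun h => h^-1 *: ((f \o shift (upd j p t)) (h *: basis3 j) - f (upd j p t))).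
  by apply/funext => h /=; rewrite upd_shift.
move=> df; apply: DeriveDef; first by rewrite /derivable E.
by rewrite /derive E.
Qed.

(** Fubini with the [j]-th variable innermost. The majorant is a tensor product at both levels of
    [R * R * R], so either order is available at each level. *)
Lemma cintegral_leb3_0 j (G : R * R * R -> R[i]) (C : R) : cmeasurable G ->
  (forall p, cabs1 (G p) <= C * weight3 p) ->
  (forall p, cintegral leb (fun t => G (upd j p t)) = 0) -> cintegral leb3 G = 0.
Proof.
move=> mG GC G0.
have c0 d (X : measurableType d) (mu : {measure set X -> \bar R}) (f : X -> R[i]) :
    (forall x, f x = 0) -> cintegral mu f = 0.
  by move=> f0; rewrite /cintegral; congr Complex;
    rewrite /Rintegral integral0_eq// => x _; rewrite f0.
have i1 := @integrable_oneDsqrV R.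
have i2 : leb2.-integrable setT (EFin \o (fun q : R * R =>
  C * ((oneDsqr q.1)^-1 * (oneDsqr q.2)^-1))).
  exact: (integrableZl measurableT C (integrable_tensor i1 i1)).
have G2 (q : (R * R)%type) (z : R) :
  cabs1 (G (q, z)) <= C * ((oneDsqr q.1)^-1 * (oneDsqr q.2)^-1) * (oneDsqr z)^-1.
  by rewrite -mulrA; exact: GC.
have mGz (z : R) : cmeasurable (fun q : (R * R)%type =>
  G (q, z)) := cmeasurable_comp mG (pair2_measurable z).
have i1z z : leb.-integrable setT (EFin \o (fun x : R =>
  (C * (oneDsqr z)^-1) * (oneDsqr x)^-1)).
  exact: (integrableZl measurableT (C * (oneDsqr z)^-1) i1).
have G1 z x y : cabs1 (G ((x, y), z)) <= (C * (oneDsqr z)^-1)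
  * (oneDsqr x)^-1 * (oneDsqr y)^-1.
  by apply: le_trans (G2 _ _) _; rewrite /= le_eqVlt; apply/orP; left; apply/eqP; ring.
case: j G0 => -[|[|[|//]]] ltj G0.
- rewrite (dominated_cFubini_left i2 i1 mG G2)//; apply: (c0) => z.
  rewrite (dominated_cFubini_left (i1z z) i1 (mGz z) (G1 z))//; apply: (c0) => y.
  exact: (G0 (0, y, z)).
- rewrite (dominated_cFubini_left i2 i1 mG G2)//; apply: (c0) => z.
  rewrite (dominated_cFubini_right (i1z z) i1 (mGz z) (G1 z))//; apply: (c0) => x.
  exact: (G0 (x, 0, z)).
- rewrite (dominated_cFubini_right i2 i1 mG G2)//; apply: (c0) => -[x y].
  exact: (G0 (x, y, 0)).
Qed.

End Coordinates.

(** * Schwartz functions and the decay of their Fourier transforms *)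

Section SchwartzFunctions.
Context {R : realType}.
Local Notation leb := (@lebesgue_measure R).
Local Notation Re := complex.Re.
Local Notation Im := complex.Im.
Implicit Types (phi : R * R * R -> R[i]) (p xi : R * R * R) (j : 'I_3) (t : R).

(** The extra derivative is appended to the word [w], so the seminorm of order [N] of the derivative
    is at most that of order [N + 1] of [phi]. *)
Lemma schwartz_pderiv phi j : schwartz phi -> schwartz (pderiv j phi).
Proof.
have E w : pderivs w (pderiv j phi) = pderivs (rcons w j)
  phi by rewrite /pderivs foldr_rcons.
move=> [dphi sphi]; split=> [w k p|N]; first by rewrite E.
apply: le_lt_trans (sphi N.+1); apply: ge_ereal_sup => _ [w [p [wN ->]]].
apply: (@le_trans _ _ (bracket2 p ^+ N.+1 * cmodulus (pderivs (rcons w j) phi p))%:E).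
  rewrite E lee_fin ler_wpM2r ?sqrtr_ge0//.
    by case: (pderivs _ _ _) => a b; exact: sqrtr_ge0.
  by rewrite ler_weXn2l// bracket2_ge1.
by apply: ereal_sup_ubound; exists (rcons w j), p; rewrite size_rcons.
Qed.

Lemma schwartz_le phi : schwartz phi -> exists C, forall p, cabs1 (phi p) <= C * weight3 p.
Proof.
move=> [_ /(_ 3)]; set S := seminorm 3 phi => Soo.
have bS p : ((bracket2 p ^+ 3 * cmodulus (phi p))%:E <= S)%E.
  by apply: ereal_sup_ubound; exists [::], p.
have Sfin : S \is a fin_num.
  rewrite fin_numElt Soo andbT; apply: lt_le_trans (bS (0, 0, 0)); exact: ltNyr.
exists (2 * fine S) => p; apply: le_trans (cabs1_le_cmodulus _) _.
rewrite -mulrA ler_pM2l//.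
have m0 : 0 <= cmodulus (phi p) by exact: le_trans (Re_le_cmodulus _).
apply: (@le_trans _ _ (bracket2 p ^+ 3 * weight3 p * cmodulus (phi p))).
  by rewrite ler_peMl// bracket2_weight3.
rewrite mulrAC ler_wpM2r ?(ltW (weight3_gt0 _))//.
by rewrite -lee_fin fineK.
Qed.

Lemma schwartz_bounded phi : schwartz phi -> exists C, forall p, cabs1 (phi p) <= C.
Proof.
move=> /schwartz_le[C hC]; exists `|C| => p; apply: le_trans (hC p) _.
apply: le_trans (ler_wpM2r (ltW (weight3_gt0 p)) (ler_norm C)) _.
by rewrite ler_piMr// weight3_le1.
Qed.

Lemma schwartz_is_derive phi j p t : schwartz phi ->
  is_derive t 1 (fun s => Re (phi (upd j p s))) (Re (pderiv j phi (upd j p t))) /\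
  is_derive t 1 (fun s => Im (phi (upd j p s))) (Im (pderiv j phi (upd j p t))).
Proof.
move=> [/(_ [::] j (upd j p t))[dRe dIm] _].
by split; [exact: (derivable_upd dRe)|exact: (derivable_upd dIm)].
Qed.

(** Partial derivatives give continuity along the axes only. The Caratheodory criterion handles [z],
    then [y], leaving a continuous function of [x]. *)
Lemma measurable_separately_continuous (f : R * R * R -> R) :
  (forall j p, continuous (fun s => f (upd j p s))) -> measurable_fun setT f.
Proof.
move=> cf.
have c0 y z : continuous (fun x => f (x, y, z)) := cf (@Ordinal 3 0 isT) (0, y, z).
have c1 x z : continuous (fun y => f (x, y, z)) := cf (@Ordinal 3 1 isT) (x, 0, z).
have c2 x y : continuous (fun z => f (x, y, z)) := cf (@Ordinal 3 2 isT) (x, y, 0).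
apply: measurable_fun_Caratheodory => [z|[x y]]; last exact: c2.
apply: (@measurable_fun_Caratheodory _ _ _ (fun q => f (q, z))) => [y|x]; last exact: c1.
by apply: continuous_measurable_fun; exact: c0.
Qed.

Lemma schwartz_measurable phi : schwartz phi -> cmeasurable phi.
Proof.
move=> sphi; split; apply: measurable_separately_continuous => j p.
  by apply: is_derive_continuous => t; exact: (schwartz_is_derive j p t sphi).1.
by apply: is_derive_continuous => t; exact: (schwartz_is_derive j p t sphi).2.
Qed.

Lemma schwartz_integrable phi : schwartz phi -> cintegrable leb3 phi.
Proof.
move=> sphi; have [C hC] := schwartz_le sphi.
have i3 := integrableZl measurableT C integrable_weight3.
exact: (@cintegrable_dominated _ _ _ leb3 phi (fun p =>
  C * weight3 p) (schwartz_measurable sphi) i3 hC).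
Qed.

(** The integrand is the derivative of [F = a cos - b sin], the real part of
    [(a + i b) e^(i(tk + c))], and [F] vanishes at both ends. *)
Lemma line_integral_by_parts (a b a' b' : R -> R) (k c C : R) :
  (forall t, is_derive t 1 a (a' t)) -> (forall t, is_derive t 1 b (b' t)) ->
  continuous a' -> continuous b' ->
  (forall t, `|a t| <= C * (oneDsqr t)^-1) -> (forall t, `|b t| <= C * (oneDsqr t)^-1) ->
  (forall t, `|a' t| <= C * (oneDsqr t)^-1) -> (forall t, `|b' t| <= C * (oneDsqr t)^-1) ->
  Rintegral leb setT (fun t =>
    (a' t * cos (t * k + c) - b' t * sin (t * k + c)) +
    (a t * - (k * sin (t * k + c)) - b t * (k * cos (t * k + c)))) = 0.
Proof.
move=> da db ca' cb' ba bb ba' bb'.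
pose F (t : R) := a t * cos (t * k + c) - b t * sin (t * k + c).
set f := (X in Rintegral _ _ X).
have dth t : is_derive t 1 (fun t : R => t * k + c) k.
  by apply: is_derive_eq; rewrite /GRing.scale/=; ring.
have dcos t : is_derive t 1 (fun t => cos (t * k + c)) (- (k * sin (t * k + c))).
  by apply: is_derive_eq; rewrite /GRing.scale/=; ring.
have dsin t : is_derive t 1 (fun t => sin (t * k + c)) (k * cos (t * k + c)).
  by apply: is_derive_eq; rewrite /GRing.scale/=; ring.
have dF t : is_derive t 1 F (f t).
  by apply: is_derive_eq; rewrite /GRing.scale/= /f; ring.
have ca := is_derive_continuous da; have cb := is_derive_continuous db.
have cc := is_derive_continuous dcos; have cs := is_derive_continuous dsin.
have cf : continuous f.
  move=> t; apply: cvgD; apply: cvgB; apply: cvgM;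
    do ?[exact: ca'|exact: cb'|exact: ca|exact: cb|exact: cc|exact: cs].
    by apply: cvgN; apply: cvgM; [exact: cvg_cst|exact: cs].
  by apply: cvgM; [exact: cvg_cst|exact: cc].
have o0 (t : R) : 0 <= (oneDsqr t)^-1 by rewrite invr_ge0.
have leM (x y z w : R) : `|x| <= z -> `|y| <= w -> `|x * y| <= z * w.
  by move=> *; rewrite normrM ler_pM.
have bk t : `|k * cos (t * k + c)| <= `|k| /\ `|- (k * sin (t * k + c))| <= `|k|.
  by rewrite normrN !normrM; split; rewrite ler_piMr// (cos_max, sin_max).
have bf t : `|f t| <= (2 * C + 2 * C * `|k|) * (oneDsqr t)^-1.
  have h1 := leM _ _ _ _ (ba' t) (cos_max (t * k + c)).
  have h2 := leM _ _ _ _ (bb' t) (sin_max (t * k + c)).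
  have h3 := leM _ _ _ _ (ba t) (bk t).2.
  have h4 := leM _ _ _ _ (bb t) (bk t).1.
  apply: le_trans (ler_normD _ _) _.
  apply: le_trans (lerD (ler_normB _ _) (ler_normB _ _)) _.
  by apply: le_trans (lerD (lerD h1 h2) (lerD h3 h4)) _; rewrite le_eqVlt; apply/orP;
    left; apply/eqP; ring.
have bF t : `|F t| <= (2 * C) * (oneDsqr t)^-1.
  have h1 := leM _ _ _ _ (ba t) (cos_max (t * k + c)).
  have h2 := leM _ _ _ _ (bb t) (sin_max (t * k + c)).
  apply: le_trans (ler_normB _ _) _.
  by apply: le_trans (lerD h1 h2) _; rewrite le_eqVlt; apply/orP; left; apply/eqP; ring.
have fi : leb.-integrable setT (EFin \o f).
  apply: (le_integrable measurableT _ _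
    (integrableZl measurableT (2 * C + 2 * C * `|k|) (@integrable_oneDsqrV R))).
    by apply/measurable_EFinP; exact: continuous_measurable_fun.
  by move=> t _ /=; rewrite lee_fin (le_trans (bf t))// ler_norm.
have lp : (fun n => F n.+1%:R) @ \oo --> (0 : R).
  by apply: (@cvg0_le_oneDsqrV _ _ (2 * C)) => n; exact: bF.
have lm : (fun n => F (- n.+1%:R)) @ \oo --> (0 : R).
  apply: (@cvg0_le_oneDsqrV _ _ (2 * C)) => n.
  by rewrite (_ : oneDsqr n.+1%:R = oneDsqr (- n.+1%:R)) // /oneDsqr sqrrN.
rewrite (Rintegral_line cf fi (is_derive_continuous dF) (is_derive_continuous dF)
  (fun t _ => dF t) (fun t _ => dF t) lp lm).
by rewrite sub0r subr0 addNr.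
Qed.

(** The sign in the exponent is that of the inverse transform: this is [ifourier] without its
    constant. *)
Definition cfourier phi (eta : R * R * R) : R[i] :=
  cintegral leb3 (fun q => phi q * expi (dot3 q eta)).

Lemma cmeasurable_character (eta : R * R * R) : cmeasurable (fun q => expi (dot3 q eta)).
Proof.
apply: cmeasurable_expi; exact: (measurableT_comp measurable_dot3 (pair2_measurable eta)).
Qed.

Lemma cintegrable_character phi (eta : R * R * R) : cintegrable leb3 phi ->
  cintegrable leb3 (fun q => phi q * expi (dot3 q eta)).
Proof.
move=> iphi.
by apply: (@cintegrableM_bounded _ _ _ leb3 _ _ 2) => // [|p];
  [exact: cmeasurable_character|exact: cabs1_expi].
Qed.

(** The function [G] of the proof is the [j]-th derivative of [phi * e], so its integral vanishes
    along every line parallel to the [j]-th axis. *)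
Lemma cfourier_pderiv phi j (eta : R * R * R) : schwartz phi ->
  cfourier (pderiv j phi) eta = - (0 +i* crd j eta) * cfourier phi eta.
Proof.
move=> sphi; have sdphi := schwartz_pderiv j sphi.
set e := fun q => expi (dot3 q eta).
set k := crd j eta.
pose G q := pderiv j phi q * e q + phi q * e q * (0 +i* k).
have i1 := cintegrable_character eta (schwartz_integrable sphi).
have i2 := cintegrable_character eta (schwartz_integrable sdphi).
suff G0 : cintegral leb3 G = 0.
  rewrite mulNr [_ * cfourier _ _]mulrC -cintegralZr//; apply/eqP.
  rewrite -subr_eq0 opprK -cintegralD//; first by rewrite [X in X == _]G0.
  exact: cintegrableZr.
have [C1 h1] := schwartz_le sphi; have [C2 h2] := schwartz_le sdphi.
have ck : cabs1 (0 +i* k) = `|k| by rewrite /cabs1/= normr0 add0r.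
apply: (@cintegral_leb3_0 _ j G (2 * C2 + 2 * C1 * `|k|)) => [|p|p].
- apply: cmeasurableD; first exact: (cintegrable_measurable i2).
  exact: (cintegrable_measurable (cintegrableZr _ i1)).
- have e2 : cabs1 (e p) <= 2 by exact: cabs1_expi.
  have ceM z : cabs1 (z * e p) <= 2 * cabs1 z.
    by apply: le_trans (cabs1M _ _) _; rewrite mulrC ler_wpM2r ?cabs1_ge0.
  apply: le_trans (cabs1D _ _) _.
  apply: le_trans (lerD (ceM _) (cabs1M _ _)) _; rewrite ck.
  have h := ler_wpM2r (normr_ge0 k) (ceM (phi p)).
  apply: le_trans (lerD (lexx _) h) _.
  have h3 := ler_wpM2r (normr_ge0 k) (h1 p).
  have := h2 p; lra.
pose c := dot3 (upd j p 0) eta.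
have eE t : e (upd j p t) = expi (t * k + c) by rewrite /e dot3_upd.
have dR t := (schwartz_is_derive j p t sphi).1.
have dI t := (schwartz_is_derive j p t sphi).2.
have cR := is_derive_continuous (fun t => (schwartz_is_derive j p t sdphi).1).
have cI := is_derive_continuous (fun t => (schwartz_is_derive j p t sdphi).2).
have C1_ge0 : 0 <= C1.
  rewrite -(pmulr_lge0 _ (weight3_gt0 (0, 0, 0))); exact: le_trans (cabs1_ge0 _) (h1 _).
have C2_ge0 : 0 <= C2.
  rewrite -(pmulr_lge0 _ (weight3_gt0 (0, 0, 0))); exact: le_trans (cabs1_ge0 _) (h2 _).
have w t C : 0 <= C -> C <= C1 + C2 -> C * weight3 (upd j p t) <= (C1 + C2)
  * (oneDsqr t)^-1.
  by move=> *; rewrite ler_pM// ?weight3_upd// ltW// weight3_gt0.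
have b1 t : cabs1 (phi (upd j p t)) <= (C1 + C2) * (oneDsqr t)^-1.
  by apply: le_trans (h1 _) _; apply: w => //; rewrite lerDl.
have b2 t : cabs1 (pderiv j phi (upd j p t)) <= (C1 + C2) * (oneDsqr t)^-1.
  by apply: le_trans (h2 _) _; apply: w => //; rewrite lerDr.
have R1 t := le_trans (Re_le_cabs1 _) (b1 t).
have I1 t := le_trans (Im_le_cabs1 _) (b1 t).
have R2 t := le_trans (Re_le_cabs1 _) (b2 t).
have I2 t := le_trans (Im_le_cabs1 _) (b2 t).
rewrite /cintegral; congr Complex.
  rewrite -[RHS](line_integral_by_parts k c dR dI cR cI R1 I1 R2 I2).
  by apply: eq_Rintegral => t _; rewrite /G eE cReD !cReM !cImM/=; ring.
(* The imaginary part is the real part for [- i phi]: the pair [(Re, Im)] becomes [(Im, - Re)]. *)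
have dR' t : is_derive t 1 (fun s =>
  - Re (phi (upd j p s))) (- Re (pderiv j phi (upd j p t))).
  by apply: is_derive_eq.
have cR' : continuous (fun t => - Re (pderiv j phi (upd j p t))).
  by move=> t; apply: cvgN; exact: cR.
have N1 t : `|- Re (phi (upd j p t))| <= (C1 + C2) * (oneDsqr t)^-1 by rewrite normrN.
have N2 t : `|- Re (pderiv j phi (upd j p t))| <= (C1 + C2)
  * (oneDsqr t)^-1 by rewrite normrN.
rewrite -[RHS](line_integral_by_parts k c dI dR' cI cR' I1 N1 I2 N2).
by apply: eq_Rintegral => t _; rewrite /G eE cImD !cImM !cReM/=; ring.
Qed.

(** Two derivatives yield the real factor [- k^2], for which [cabs1] is exactly homogeneous. *)
Lemma cabs1_cfourier_pderiv2 phi j (eta : R * R * R) : schwartz phi ->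
  cabs1 (cfourier (pderiv j (pderiv j phi)) eta) =
  crd j eta ^+ 2 * cabs1 (cfourier phi eta).
Proof.
move=> sphi; rewrite !cfourier_pderiv//; last exact: schwartz_pderiv.
case: (cfourier phi eta) => a b; set k := crd j eta.
rewrite (_ : _ * _ = (- k ^+ 2)%:C * (a +i* b)); last by apply: complex_ext => /=; ring.
by rewrite /cabs1/= !mul0r subr0 addr0 !normrM -mulrDr normrN (ger0_norm (sqr_ge0 k)).
Qed.

(** Induction on [s]: the new factor [1 + eta_j^2] splits into the bound for [phi] and the bound for
    its second [j]-th derivative. Applied to the three axes, it gives decay like [weight3]. *)
Lemma cfourier_prod_le (s : seq 'I_3) phi : schwartz phi ->
  exists C, forall eta, (\prod_(j <- s) oneDsqr (crd j eta)) * cabs1 (cfourier phi eta)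
    <= C.
Proof.
elim: s phi => [|j s IH] phi sphi.
  have iphi := schwartz_integrable sphi.
  have i2 := integrableZr measurableT 2 (integrable_cabs1 iphi).
  exists (Rintegral leb3 setT (fun p => cabs1 (phi p) * 2)) => eta; rewrite big_nil mul1r.
  apply: (@cabs1_cintegral_le _ _ _ leb3 _ _ _ i2) => [|p].
    exact: (cintegrable_measurable (cintegrable_character eta iphi)).
  apply: le_trans (cabs1M _ _) _; apply: ler_wpM2l; first exact: cabs1_ge0.
  exact: cabs1_expi.
have [C1 h1] := IH _ sphi.
have [C2 h2] := IH _ (schwartz_pderiv j (schwartz_pderiv j sphi)).
exists (C1 + C2) => eta; rewrite big_cons.
apply: le_trans (lerD (h1 eta) (h2 eta)).
by rewrite cabs1_cfourier_pderiv2// /oneDsqr le_eqVlt; apply/orP; left; apply/eqP; ring.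
Qed.

Lemma cfourier_le phi : schwartz phi ->
  exists C, forall eta, cabs1 (cfourier phi eta) <= C * weight3 eta.
Proof.
move=> sphi.
have [C hC] := cfourier_prod_le [:: @Ordinal 3 0 isT; @Ordinal 3 1 isT;
  @Ordinal 3 2 isT] sphi.
exists C => eta; have := hC eta; rewrite !big_cons big_nil mulr1 mulrA /crd/=.
by rewrite mulrC /weight3 -!invfM ler_pdivlMr// !mulr_gt0.
Qed.

Lemma cintegrable_cfourier phi : schwartz phi -> cintegrable leb3 (cfourier phi).
Proof.
move=> sphi; have [C hC] := cfourier_le sphi.
have i3 := integrableZl measurableT C integrable_weight3.
apply: (@cintegrable_dominated _ _ _ leb3 _ (fun p => C * weight3 p) _ i3 hC).
apply: (@cmeasurable_cintegral_param _ _ _ _ _ leb3 (fun r =>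
  phi r.2 * expi (dot3 r.2 r.1))).
apply: cmeasurableM.
  exact: (cmeasurable_comp (schwartz_measurable sphi)).
apply: cmeasurable_expi.
by under eq_fun do rewrite dot3C; exact: measurable_dot3.
Qed.

Lemma cintegrable_ifourier phi : schwartz phi -> cintegrable leb3 (ifourier phi).
Proof.
move=> /cintegrable_cfourier i; rewrite (_ : ifourier phi = fun p =>
  cfourier phi p * (((2 * pi) ^+ 3)^-1)%:C); first exact: cintegrableZr.
apply/funext => p; rewrite mulrC /ifourier; congr (_ * _).
by apply: eq_cintegral => q; rewrite dot3C.
Qed.

End SchwartzFunctions.

(** * The initial datum and its Fourier transform *)

Section Counterexample.
Context {R : realType}.
Local Notation leb := (@lebesgue_measure R).
Implicit Types (phi chi : R * R * R -> R[i]) (p q xi : R * R * R) (L t : R).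

(** The factor [1 *] keeps the first exponential in the form [e^(-(a|x|))], here with [a = 1],
    treated by the one-variable lemmas. *)
Definition datum L p : R :=
  expR (- (1 * `|p.1.1|)) * expR (- (L * `|p.1.2|)) * expR (- (L * `|p.2|)).

Definition datum_hat L xi : R :=
  pkernel 1 xi.1.1 * pkernel L xi.1.2 * pkernel L xi.2.

Definition datum_distribution L : distribution3 (R := R) :=
  fun psi => cintegral leb3 (fun p => (datum L p)%:C * psi p).

Definition multiplier t xi : R[i] := expi (- (t * (xi.1.1 ^+ 2 + xi.1.2 ^+ 2 + xi.2))).

Definition datum_evolution L p t : R[i] :=
  ifourier (fun xi => (datum_hat L xi)%:C * multiplier t xi) p.

Lemma integrable_expR_abs a : 1 <= a ->
  leb.-integrable setT (EFin \o (fun x => expR (- (a * `|x|)))).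
Proof.
move=> a1.
apply: (le_integrable measurableT _ _ (integrableZl measurableT 4 (@integrable_oneDsqrV
  R))).
  apply/measurable_EFinP; apply: measurableT_comp => //.
  apply: measurableT_comp => //; exact: measurable_funM.
move=> x _ /=; rewrite lee_fin [leRHS]ger0_norm ?mulr_ge0 ?invr_ge0//.
by rewrite ger0_norm ?expR_ge0// expR_abs_le.
Qed.

Lemma cintegrable_real d (X : measurableType d) (mu : {measure set X -> \bar R}) (h :
  X -> R) :
  mu.-integrable setT (EFin \o h) -> cintegrable mu (fun x => (h x)%:C).
Proof.
move=> ih; apply: (cintegrable_dominated _ (integrable_norm ih)) => [|x];
  last by rewrite cabs1_real.
by apply: cmeasurable_real; apply/measurable_EFinP; exact: measurable_int ih.
Qed.

Lemma integrable_tensor3 (a b c : R -> R) : leb.-integrable setT (EFin \o a) ->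
  leb.-integrable setT (EFin \o b) -> leb.-integrable setT (EFin \o c) ->
  leb3.-integrable setT (EFin \o (fun p : R * R * R => a p.1.1 * b p.1.2 * c p.2)).
Proof.
move=> ia ib ic; have iab : leb2.-integrable setT _ := integrable_tensor ia ib.
exact: (integrable_tensor iab ic).
Qed.

Lemma integrable_datum L : 1 <= L -> leb3.-integrable setT (EFin \o datum L).
Proof.
move=> /integrable_expR_abs iL.
exact: (integrable_tensor3 (integrable_expR_abs (lexx 1)) iL iL).
Qed.

Lemma integrable_datum_hat L : 1 <= L -> leb3.-integrable setT (EFin \o datum_hat L).
Proof.
move=> /integrable_pkernel iL.
exact: (integrable_tensor3 (integrable_pkernel (lexx 1)) iL iL).
Qed.

Lemma fourier_datum L xi : 1 <= L ->
  cintegral leb3 (fun p => (datum L p)%:C * expi (- dot3 xi p)) = (datum_hat L xi)%:C.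
Proof.
move=> L1.
pose E a x (y : R) : R[i] := (expR (- (a * `|y|)))%:C * expi (- (y * x)).
have iE a x : 1 <= a -> cintegrable leb (E a x).
  move=> a1; apply: (@cintegrableM_bounded _ _ _ leb _ _ 2) => [||y];
    last exact: cabs1_expi.
    exact: cintegrable_real (integrable_expR_abs a1).
  apply: cmeasurable_expi; apply: continuous_measurable_fun => z.
  by apply: cvgN; apply: cvgM; [exact: cvg_id|exact: cvg_cst].
pose x1 := xi.1.1; pose x2 := xi.1.2; pose x3 := xi.2.
have iE2 : cintegrable leb2 _ := cintegrable_tensor (iE 1 x1 (lexx 1)) (iE L x2 L1).
transitivity (cintegral leb3 (fun p => E 1 x1 p.1.1 * E L x2 p.1.2 * E L x3 p.2)).
  apply: eq_cintegral => p; rewrite /datum /dot3 /E.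
  rewrite (_ : - (_ + _) = - (p.1.1 * x1) + - (p.1.2 * x2) + - (p.2 * x3));
    last by rewrite /x1 /x2 /x3; ring.
  by rewrite !expiD !rmorphM/=; ring.
transitivity (cintegral leb2 (fun w : (R * R)%type =>
  E 1 x1 w.1 * E L x2 w.2) * cintegral leb (E L x3)).
  exact: (cintegral_tensor iE2 (iE L x3 L1)).
rewrite [cintegral leb2 _](cintegral_tensor (iE 1 x1 (lexx 1)) (iE L x2 L1)).
by rewrite !fourier_expR_abs// /datum_hat !rmorphM.
Qed.

(** The multiplication formula. Integrability of [chi] is the right generality: besides Schwartz
    functions, it is applied to [multiplier t] times [ifourier phi]. *)
Lemma datum_distribution_fourier L chi : 1 <= L -> cintegrable leb3 chi ->
  datum_distribution L (fourier chi) = cintegral leb3 (fun xi =>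
    (datum_hat L xi)%:C * chi xi).
Proof.
move=> L1 ichi.
pose k (r : (R * R * R) * (R * R * R)) := expi (- dot3 r.2 r.1).
have mk : cmeasurable k.
  apply: cmeasurable_expi; apply: measurableT_comp => //.
  by under eq_fun do rewrite dot3C; exact: measurable_dot3.
have := @cintegral_kernel_swap _ _ _ _ _ leb3 leb3 _ _ k 2
  (cintegrable_real (integrable_datum L1)) ichi mk (fun r => cabs1_expi _).
rewrite /datum_distribution /fourier => ->.
by apply: eq_cintegral => xi; rewrite fourier_datum.
Qed.

(** As the datum is integrable, the seminorm of order [0], the supremum of the modulus, controls the
    pairing. The factor [2] pays for passing between [cabs1] and the modulus. *)
Lemma tempered_datum L : 1 <= L -> tempered (datum_distribution L).
Proof.
move=> L1.
have mf := cintegrable_measurable (cintegrable_real (integrable_datum L1)).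
have d0 p : 0 <= datum L p by rewrite /datum !mulr_ge0 ?expR_ge0.
have int phi : schwartz phi -> cintegrable leb3 (fun p => (datum L p)%:C * phi p).
  move=> sphi; have [C hC] := schwartz_bounded sphi.
  apply: (@cintegrableM_bounded _ _ _ leb3 _ _ C) => //; last exact: schwartz_measurable.
  exact: cintegrable_real (integrable_datum L1).
split.
  move=> a phi psi sphi spsi; rewrite /datum_distribution.
  rewrite -cintegralZl; last exact: int.
  rewrite -cintegralD; [|by under eq_fun do rewrite mulrC; apply: cintegrableZr;
    exact: int|exact: int].
  by apply: eq_cintegral => p; ring.
exists 0%N, (2 * Rintegral leb3 setT (datum L)) => phi sphi.
have := sphi.2 0%N; set S := seminorm 0 phi => Soo.
have bS p : ((cmodulus (phi p))%:E <= S)%E.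
  by apply: ereal_sup_ubound; exists [::], p; rewrite expr0 mul1r.
have Sfin : S \is a fin_num.
  rewrite fin_numElt Soo andbT; apply: lt_le_trans (bS (0, 0, 0)); exact: ltNyr.
rewrite -(fineK Sfin) -EFinM lee_fin.
apply: le_trans (cmodulus_le_cabs1 _) _.
rewrite mulrAC -RintegralZl//; last exact: integrable_datum.
have i := integrableZl measurableT (2 * fine S) (integrable_datum L1).
apply: (@cabs1_cintegral_le _ _ _ leb3 _ (fun p => 2 * fine S * datum L p) _ i) => [|p].
  exact: cintegrable_measurable (int _ sphi).
apply: le_trans (cabs1M _ _) _; rewrite cabs1_real ger0_norm// mulrC ler_wpM2r//.
by apply: le_trans (cabs1_le_cmodulus _) _; rewrite ler_pM2l// -lee_fin fineK.
Qed.

Lemma represents_datum_hat L : 1 <= L ->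
  represents (dfourier (datum_distribution L)) (fun xi => (datum_hat L xi)%:C).
Proof.
move=> L1; have ig := cintegrable_real (integrable_datum_hat L1).
split; first exact: cintegrable_measurable ig.
move=> phi sphi; split; last exact: datum_distribution_fourier (schwartz_integrable sphi).
have [C hC] := schwartz_bounded sphi.
by apply: (@cintegrableM_bounded _ _ _ leb3 _ _ C) => //; exact: schwartz_measurable.
Qed.

End Counterexample.

(** * The evolution of the datum as a function *)

Section Evolution.
Context {R : realType}.
Local Notation leb := (@lebesgue_measure R).
Implicit Types (phi chi : R * R * R -> R[i]) (p q xi : R * R * R) (L t : R).

Lemma cmeasurable_multiplier :
  cmeasurable (fun r : R * (R * R * R) => multiplier r.1 r.2).
Proof.
apply: cmeasurable_expi; apply: measurableT_comp => //.
apply: measurable_funM => //; apply: measurable_funD; last exact: measurableT_comp.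
by apply: measurable_funD; apply: measurable_funX;
  do ![exact: measurableT_comp|apply: measurableT_comp => //].
Qed.

Lemma cintegrable_datum_hat_multiplier L t : 1 <= L ->
  cintegrable leb3 (fun xi => (datum_hat L xi)%:C * multiplier t xi).
Proof.
move=> L1; apply: (@cintegrableM_bounded _ _ _ leb3 _ _ 2) => [||xi];
  last exact: cabs1_expi.
  exact: cintegrable_real (integrable_datum_hat L1).
exact: (cmeasurable_comp cmeasurable_multiplier (pair1_measurable t)).
Qed.

Lemma cmeasurable_datum_evolution L : 1 <= L ->
  cmeasurable (fun r : (R * R * R) * R => datum_evolution L r.1 r.2).
Proof.
move=> L1; apply: cmeasurableM; first exact: cmeasurable_cst.
apply: (@cmeasurable_cintegral_param _ _ _ _ _ leb3
  (fun w : ((R * R * R) * R) * (R * R * R) =>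
    (datum_hat L w.2)%:C * multiplier w.1.2 w.2 * expi (dot3 w.1.1 w.2))).
have mg := cintegrable_measurable (cintegrable_real (integrable_datum_hat L1)).
apply: cmeasurableM; first apply: cmeasurableM.
- exact: (cmeasurable_comp mg).
- apply: (cmeasurable_comp cmeasurable_multiplier (h := fun w => (w.1.2, w.2))).
  apply: measurable_fun_pair => //; exact: measurableT_comp.
- apply: cmeasurable_expi.
  apply: (measurableT_comp measurable_dot3 (g := fun w => (w.1.1, w.2))).
  apply: measurable_fun_pair => //; exact: measurableT_comp.
Qed.

(** Two multiplication formulas: the first moves the Fourier transform onto the datum, the second
    moves the inverse transform from [phi] onto [datum_hat L * multiplier t]. *)
Lemma represents_datum_evolution L t : 1 <= L ->
  represents (evolution t (datum_distribution L)) (fun p => datum_evolution L p t).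
Proof.
move=> L1.
have ig := cintegrable_datum_hat_multiplier t L1.
have mu : cmeasurable (fun p => datum_evolution L p t).
  exact: (cmeasurable_comp (cmeasurable_datum_evolution L1) (pair2_measurable t)).
split=> // phi sphi; split.
  rewrite (_ : (fun p => _) = fun p => phi p * datum_evolution L p t); last first.
    by apply/funext => p; rewrite mulrC.
  (* A bound for the evolution uniform in [p], coming from the [L^1] norm of its symbol. *)
  pose B := cabs1 ((((2 * pi) ^+ 3)^-1)%:C : R[i]) *
    Rintegral leb3 setT (fun xi => cabs1 ((datum_hat L xi)%:C * multiplier t xi) * 2).
  apply: (@cintegrableM_bounded _ _ _ leb3 _ _ B) => // [|p];
    first exact: schwartz_integrable.
  apply: le_trans (cabs1M _ _) _; rewrite ler_wpM2l ?cabs1_ge0//.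
  have i := integrableZr measurableT 2 (integrable_cabs1 ig).
  apply: (@cabs1_cintegral_le _ _ _ leb3 _ _ _ i) => [|xi].
    under eq_fun do rewrite dot3C.
    exact: (cintegrable_measurable (cintegrable_character p ig)).
  by apply: le_trans (cabs1M _ _) _; rewrite ler_wpM2l ?cabs1_ge0// cabs1_expi.
have imphi : cintegrable leb3 (fun xi => multiplier t xi * ifourier phi xi).
  under eq_fun do rewrite mulrC.
  apply: (@cintegrableM_bounded _ _ _ leb3 _ _ 2) => [||xi]; last exact: cabs1_expi.
    exact: cintegrable_ifourier.
  exact: (cmeasurable_comp cmeasurable_multiplier (pair1_measurable t)).
have E : evolution t (datum_distribution L) phi = datum_distribution L
  (fourier (fun xi => multiplier t xi * ifourier phi xi)) by [].
rewrite {}E datum_distribution_fourier//.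
have mk : cmeasurable (fun r : (R * R * R) * (R * R * R) => expi (dot3 r.1 r.2)).
  by apply: cmeasurable_expi; exact: measurable_dot3.
pose c : R[i] := (((2 * pi) ^+ 3)^-1)%:C.
have icg : cintegrable leb3 (fun xi => (datum_hat L xi)%:C * multiplier t xi * c).
  exact: cintegrableZr.
transitivity (cintegral leb3 (fun xi => (datum_hat L xi)%:C * multiplier t xi * c *
    cintegral leb3 (fun p => phi p * expi (dot3 xi p)))).
  apply: eq_cintegral => xi; rewrite /ifourier -/c.
  by rewrite mulrA [_ * c]mulrC mulrA [_ * c]mulrC.
rewrite (@cintegral_kernel_swap _ _ _ _ _ leb3 leb3 _ _ (fun r => expi (dot3 r.1 r.2)) 2)//.
- apply: eq_cintegral => p; congr (_ * _); rewrite /datum_evolution /ifourier -/c.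
  rewrite -cintegralZl; last by under eq_fun do rewrite dot3C; exact: cintegrable_character.
  by apply: eq_cintegral => xi /=; rewrite [dot3 p xi]dot3C mulrAC mulrC.
- exact: schwartz_integrable.
- by move=> r; exact: cabs1_expi.
Qed.

End Evolution.

(** * Smallness of the Sobolev norm *)

Section SobolevBound.
Context {R : realType}.
Local Notation leb := (@lebesgue_measure R).
Implicit Types (xi : R * R * R) (L s e : R).

Lemma datum_hat_gt0 L xi : 1 <= L -> 0 < datum_hat L xi.
Proof.
move=> L1; have L0 : 0 < L by apply: lt_le_trans L1.
have p0 a x : 0 < a -> 0 < pkernel a x :> R by move=> a0;
  rewrite divr_gt0 ?mulr_gt0 ?sqrD_gt0.
by apply: mulr_gt0; [apply: mulr_gt0|]; apply: (p0).
Qed.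

Lemma datum_hatE L x y z : 1 <= L -> datum_hat L (x, y, z) =
  8 * L ^+ 2 / ((1 + x ^+ 2) * (L ^+ 2 + y ^+ 2) * (L ^+ 2 + z ^+ 2)).
Proof.
move=> L1; have L0 : 0 < L by apply: lt_le_trans L1.
rewrite /datum_hat /pkernel/=; field.
have o : 0 < 1 + x ^+ 2 by rewrite ltr_pwDl ?sqr_ge0.
by rewrite !gt_eqF ?sqrD_gt0 ?o.
Qed.

Lemma bracket2_datum_hat L xi : 1 <= L -> bracket2 xi * datum_hat L xi <= 8.
Proof.
move=> L1; have L0 : 0 < L by apply: lt_le_trans L1.
case: xi => -[x y] z; rewrite datum_hatE// /bracket2 /dot3/= mulrA ler_pdivrMr; last first.
  by rewrite !mulr_gt0 ?sqrD_gt0// ltr_pwDl ?sqr_ge0.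
rewrite -!expr2.
have A1 : 1 <= L ^+ 2 by rewrite expr_ge1// ltW.
have := sqr_ge0 x; have := sqr_ge0 y; have := sqr_ge0 z.
move: (x ^+ 2) (y ^+ 2) (z ^+ 2) (L ^+ 2) A1 => X Y Z A A1 Z0 Y0 X0.
suff : A * (1 + (X + Y + Z)) <= (1 + X) * (A + Y) * (A + Z) by lra.
(* The right side minus the left is the sum of the nonnegative terms [h3] to [h7]. *)
have h1 : 0 <= X * Y by rewrite mulr_ge0.
have h2 : 0 <= X * Z by rewrite mulr_ge0.
have h3 : 0 <= Y * Z by rewrite mulr_ge0.
have h4 : 0 <= X * (Y * Z) by rewrite mulr_ge0.
have h5 : 0 <= A * (A - 1) * (1 + X) by rewrite !mulr_ge0//; lra.
have h6 : 0 <= A * (X * Y) by rewrite mulr_ge0//; lra.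
have h7 : 0 <= A * (X * Z) by rewrite mulr_ge0//; lra.
lra.
Qed.

(** The suprema [2/a] of the three kernels multiply to [8/L^2], which is weakened to [8/L]. *)
Lemma datum_hat_le L xi : 1 <= L -> datum_hat L xi <= 8 / L.
Proof.
move=> L1; have L0 : 0 < L by apply: lt_le_trans L1.
have pk a x : 0 < a -> pkernel a x <= 2 / a.
  move=> a0; rewrite ler_pdivlMr// /pkernel mulrAC ler_pdivrMr ?sqrD_gt0//.
  by rewrite mulrDr -mulrA -expr2 lerDl mulr_ge0 ?sqr_ge0.
have p0 a x : 0 < a -> 0 <= pkernel a x :> R by move=> /ltW; exact: pkernel_ge0.
apply: (@le_trans _ _ (2 / 1 * (2 / L) * (2 / L))).
  apply: ler_pM; [apply: mulr_ge0; exact: p0|exact: p0|apply: ler_pM|exact: pk];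
    do ?[exact: p0|exact: pk].
have iL : 0 <= L^-1 <= 1 by rewrite invr_ge0 (ltW L0) invf_le1.
have iL2 : L^-1 * L^-1 <= L^-1 by case/andP: iL => i1 i2; rewrite ler_piMr.
by rewrite invr1; lra.
Qed.

(** With [b = bracket2 xi] and [g = datum_hat L xi <= d], one has [b^sg g = (b g)^sg g^(1 - sg) <=
    8^sg d^(1 - sg)]. The hypothesis [s < 1] makes the last exponent positive, so a small [d]
    suffices. *)
Lemma bracket2_powR_datum_hat s e : s < 1 -> 0 < e ->
  (* Since [bracket2 >= 1], passing to the positive part of [s] only increases the power, and it
     keeps the exponents nonnegative. *)
  exists2 L, 1 <= L & forall xi, bracket2 xi `^ s * datum_hat L xi <= e.
Proof.
move=> s1 e0; pose sg := Num.max s 0.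
have sg1 : 0 < 1 - sg by rewrite subr_gt0 gt_max s1 ltr01.
have sg0 : 0 <= sg by rewrite le_max lexx orbT.
have e8 : 0 < e / 8 `^ sg by rewrite divr_gt0// powR_gt0.
(* The solution of [8^sg d^(1 - sg) = e]. *)
pose d := (e / 8 `^ sg) `^ (1 - sg)^-1.
have d0 : 0 < d by rewrite powR_gt0.
(* This [L] is at least [1] and satisfies [8/L <= d]. *)
exists (1 + 8 / d) => [|xi]; first by rewrite lerDl divr_ge0// ltW.
set L := 1 + 8 / d.
have L1 : 1 <= L by rewrite lerDl divr_ge0// ltW.
have g0 := datum_hat_gt0 xi L1.
have b1 := bracket2_ge1 xi; have b0 : 0 < bracket2 xi by apply: lt_le_trans b1.
have gd : datum_hat L xi <= d.
  apply: le_trans (datum_hat_le _ L1) _.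
  by rewrite ler_pdivrMr ?(lt_le_trans ltr01)// mulrDr mulr1 mulrC divfK ?gt_eqF// lerDr
    ltW.
apply: (@le_trans _ _ (bracket2 xi `^ sg * datum_hat L xi)).
  by rewrite ler_wpM2r ?(ltW g0)// ler_powR// le_max lexx.
have gE : datum_hat L xi = datum_hat L xi `^ sg * datum_hat L xi `^ (1 - sg).
  by rewrite -powRD ?subrKC ?powRr1 ?(ltW g0)// (gt_eqF g0) implybT.
rewrite [X in _ * X]gE.
rewrite mulrA -powRM ?(ltW g0) ?(ltW b0)//.
apply: (@le_trans _ _ (8 `^ sg * d `^ (1 - sg))).
  have bg0 := mulr_ge0 (ltW b0) (ltW g0).
  have bg8 := bracket2_datum_hat xi L1.
  apply: ler_pM; rewrite ?powR_ge0//.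
    by apply: ge0_ler_powR; rewrite ?nnegrE.
  by apply: ge0_ler_powR; rewrite ?nnegrE ?(ltW d0) ?(ltW g0) ?(ltW sg1).
rewrite /d -powRrM mulVf ?gt_eqF// powRr1 ?(ltW e8)//.
by rewrite mulrC divfK// gt_eqF// powR_gt0.
Qed.

Lemma Rintegral_datum_hat L : 1 <= L -> Rintegral leb3 setT (datum_hat L) = (2 * pi) ^+ 3.
Proof.
move=> L1; have i1 := integrable_pkernel (lexx (1 : R)); have iL := integrable_pkernel L1.
transitivity (Rintegral leb2 setT (fun w : (R * R)%type => pkernel 1 w.1 * pkernel L w.2) *
  Rintegral leb setT (pkernel L)).
  exact: (Rintegral_tensor (integrable_tensor i1 iL : leb2.-integrable setT _) iL).
rewrite [X in X * _](Rintegral_tensor i1 iL) !Rintegral_pkernel//.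
by rewrite !exprS expr0 mulr1 mulrA.
Qed.

(** The infimum is at most its value at the representative [datum_hat L]. There one factor of the
    square absorbs the weight, leaving [e], and the other has mass [(2 pi)^3]. *)
Lemma sobolev_norm_datum_le L s e : 1 <= L ->
  (forall xi, bracket2 xi `^ s * datum_hat L xi <= e) ->
  (sobolev_norm s (datum_distribution L) <= (Num.sqrt (e * (2 * pi) ^+ 3))%:E)%E.
Proof.
move=> L1 he.
have e0 : 0 <= e.
  by apply: le_trans (he (0, 0, 0)); rewrite mulr_ge0 ?powR_ge0// ltW// datum_hat_gt0.
apply: ereal_inf_le; eexists.
  by exists (fun xi => (datum_hat L xi)%:C); [exact: represents_datum_hat|reflexivity].
have Ile : (\int[leb3]_xi (bracket2 xi `^ s * cmodulus (datum_hat L xi)%:C ^+ 2)%:E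
    <= (e * (2 * pi) ^+ 3)%:E)%E.
  rewrite -(Rintegral_datum_hat L1) -RintegralZl//; last exact: integrable_datum_hat.
  have ieg := integrableZl measurableT e (integrable_datum_hat L1).
  rewrite /Rintegral fineK; last exact: (integrable_fin_num measurableT ieg).
  apply: ge0_le_integralT => xi; first by rewrite lee_fin mulr_ge0 ?powR_ge0 ?sqr_ge0.
  have g0 := datum_hat_gt0 xi L1.
  rewrite lee_fin cmodulus_real ger0_norm ?(ltW g0)// expr2 mulrA.
  by rewrite ler_wpM2r// ltW.
have I0 : (0 <= \int[leb3]_xi (bracket2 xi `^ s * cmodulus (datum_hat L xi)%:C ^+ 2)%:E)%E.
  by apply: integral_ge0 => xi _; rewrite lee_fin mulr_ge0 ?powR_ge0 ?sqr_ge0.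
have ep0 : 0 <= e * (2 * pi) ^+ 3 by rewrite mulr_ge0// exprn_ge0// mulr_ge0// pi_ge0.
rewrite -powR12_sqrt// -poweR_EFin; apply: gt0_ler_poweR => //.
- by rewrite in_itv/= leey andbT; exact: I0.
- by rewrite in_itv/= leey andbT lee_fin.
Qed.

End SobolevBound.

(** * Pointwise lower bound for the evolution near the origin *)

Section LowerBound.
Context {R : realType}.
Local Notation leb := (@lebesgue_measure R).
Implicit Types (p xi : R * R * R) (L M t x y z : R).

Lemma normr_sin_le x : `|sin x| <= `|x|.
Proof.
wlog x0 : x / 0 <= x => [h|].
  by case: (leP 0 x) => [/h//|/ltW x0]; rewrite -normrN -sinN -[leRHS]normrN h// oppr_ge0.
have [|c _] := @MVT_segment R sin cos 0 x x0.
  by apply: continuous_subspaceT; exact: continuous_sin.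
by rewrite sin0 !subr0 => ->; rewrite normrM ler_piMl// cos_max.
Qed.

(** From [cos x = 1 - 2 sin^2(x/2)] and [|sin(x/2)| <= 1/2]. *)
Lemma cos_ge_half x : `|x| <= 1 -> 2^-1 <= cos x.
Proof.
move=> x1; have -> : cos x = 1 - 2 * sin (x / 2) ^+ 2.
  by rewrite sin2cos2 -[in LHS](@divfK _ 2 _ x)// mulr_natr cos_mulr2n; ring.
have : `|sin (x / 2)| <= 2^-1.
  apply: le_trans (normr_sin_le _) _.
  by rewrite normrM [X in _ * X]ger0_norm// ler_piMl.
rewrite -real_normK ?num_real//; have := normr_ge0 (sin (x / 2)); nra.
Qed.

Lemma exists_large_box : exists2 M : R, 0 < M & 9 / 10 * (2 * pi) ^+ 3 <= (4 * atan M) ^+ 3.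
Proof.
have pi0 := pi_gt0 R.
(* With [M = tan a], each variable keeps the fraction [97/100] of its mass, and
   [(97/100)^3 > 9/10]. *)
pose a : R := 97 / 100 * (pi / 2).
have a0 : 0 < a by rewrite /a; lra.
have aK : atan (tan a) = a by rewrite tanK// in_itv/= /a; lra.
exists (tan a).
  rewrite ltNge; apply/negP => /le_atan; rewrite aK atan0; lra.
rewrite aK (_ : 4 * a = 97 / 100 * (2 * pi)); last by rewrite /a; field.
have : 0 < 2 * pi :> R by rewrite mulr_gt0.
by move: (2 * pi) => P P0; rewrite exprMn ler_pM2r ?exprn_gt0//; lra.
Qed.

Lemma Re_datum_evolution L p t : complex.Re (datum_evolution L p t) =
  ((2 * pi) ^+ 3)^-1 * Rintegral leb3 setT (fun xi => datum_hat L xi *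
    cos (- (t * (xi.1.1 ^+ 2 + xi.1.2 ^+ 2 + xi.2)) + dot3 p xi)).
Proof.
have ReZ (c : R) (w : R[i]) : complex.Re (c%:C * w) = c * complex.Re w.
  by rewrite cReM/= mul0r subr0.
rewrite /datum_evolution /ifourier ReZ; congr (_ * _).
by apply: eq_Rintegral => xi _; rewrite /multiplier -mulrA -expiD ReZ.
Qed.

Definition pkernel_trunc L M : R -> R := pkernel L \_ `[- (M * L), M * L].

Lemma pkernel_truncE L M x :
  pkernel_trunc L M x = if `|x| <= M * L then pkernel L x else 0.
Proof. by rewrite /pkernel_trunc patchE mem_setE in_itv/= -ler_norml. Qed.

Lemma integrable_pkernel_trunc L M : 1 <= L ->
  leb.-integrable setT (EFin \o pkernel_trunc L M).
Proof.
move=> L1; have L0 : 0 < L by apply: lt_le_trans L1.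
apply: (le_integrable measurableT _ _ (integrable_pkernel L1)).
  apply/measurable_EFinP/(measurable_restrictT _ _).1 => //.
  by apply: measurable_funTS; apply: continuous_measurable_fun; exact: continuous_pkernel.
move=> x _ /=; rewrite lee_fin /pkernel_trunc patchE; case: ifP => // _.
by rewrite normr0.
Qed.

Lemma Rintegral_pkernel_trunc L M : 1 <= L -> 0 < M ->
  Rintegral leb setT (pkernel_trunc L M) = 4 * atan M.
Proof.
move=> L1 M0; have L0 : 0 < L by apply: lt_le_trans L1.
by rewrite -Rintegral_mkcond Rintegral_pkernel_itv.
Qed.

(** The cutoff to the box is a product of one-variable cutoffs, so its integral factors. *)
Definition datum_hat_trunc L M xi : R :=
  pkernel_trunc 1 M xi.1.1 * pkernel_trunc L M xi.1.2 * pkernel_trunc L M xi.2.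

Lemma integrable_datum_hat_trunc L M : 1 <= L ->
  leb3.-integrable setT (EFin \o datum_hat_trunc L M).
Proof.
move=> /(integrable_pkernel_trunc M) iL.
exact: (integrable_tensor3 (integrable_pkernel_trunc M (lexx 1)) iL iL).
Qed.

Lemma Rintegral_datum_hat_trunc L M : 1 <= L -> 0 < M ->
  Rintegral leb3 setT (datum_hat_trunc L M) = (4 * atan M) ^+ 3.
Proof.
move=> L1 M0; have i1 := integrable_pkernel_trunc M (lexx (1 : R)).
have iL := integrable_pkernel_trunc M L1.
transitivity (Rintegral leb2 setT (fun w : (R * R)%type =>
  pkernel_trunc 1 M w.1 * pkernel_trunc L M w.2) * Rintegral leb setT (pkernel_trunc L M)).
  exact: (Rintegral_tensor (integrable_tensor i1 iL : leb2.-integrable setT _) iL).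
rewrite [X in X * _](Rintegral_tensor i1 iL) !Rintegral_pkernel_trunc//.
by rewrite !exprS expr0 mulr1 mulrA.
Qed.

(* On the box [|xi_1| <= M, |xi_2|, |xi_3| <= M L], which carries most of the mass of the
   symbol uniformly in [L], the phase is at most 1; elsewhere the cosine is at least -1. *)
Lemma datum_evolution_ge L M x y z t : 1 <= L -> 0 < M ->
  9 / 10 * (2 * pi) ^+ 3 <= (4 * atan M) ^+ 3 ->
  `|t| * (M ^+ 2 + (M * L) ^+ 2 + M * L) + (`|x| * M + `|y| * (M * L) + `|z| * (M * L))
    <= 1 ->
  4^-1 <= complex.Re (datum_evolution L (x, y, z) t).
Proof.
move=> L1 M0 hM small; have L0 : 0 < L by apply: lt_le_trans L1.
have pi3 : 0 < (2 * pi) ^+ 3 :> R by rewrite exprn_gt0// mulr_gt0// pi_gt0.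
rewrite Re_datum_evolution mulrC ler_pdivlMr//.
pose th (xi : R * R * R) :=
  - (t * (xi.1.1 ^+ 2 + xi.1.2 ^+ 2 + xi.2)) + dot3 (x, y, z) xi.
have ig := integrable_datum_hat L1; have ib := integrable_datum_hat_trunc M L1.
have ib2 : leb3.-integrable setT (EFin \o (fun xi => 3 / 2 * datum_hat_trunc L M xi)).
  exact: (integrableZl measurableT (3 / 2) ib).
have mcos : measurable_fun setT (fun xi => cos (th xi)).
  have mm := cmeasurable_comp (@cmeasurable_multiplier R) (pair1_measurable t).
  have mc := cmeasurable_character (x, y, z).
  apply: (eq_measurable_fun _ _ (cmeasurableM mm mc).1) => xi _ /=.
  by rewrite /multiplier /th -cosD dot3C.
have igc : leb3.-integrable setT (EFin \o (fun xi => datum_hat L xi * cos (th xi))).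
  apply: (le_integrable measurableT _ _ ig).
    apply/measurable_EFinP; apply: measurable_funM => //.
    by apply/measurable_EFinP; exact: measurable_int ig.
  move=> xi _ /=; rewrite lee_fin normrM ler_piMr//.
  exact: cos_max.
(* This minorant equals half of [datum_hat] on the box and [- datum_hat] off it. Its integral is at
   least [3/2 * 9/10 - 1 = 7/20] of the total mass, which exceeds [1/4]. *)
apply: (@le_trans _ _ (Rintegral leb3 setT (fun xi =>
  3 / 2 * datum_hat_trunc L M xi - datum_hat L xi))).
  rewrite RintegralB// RintegralZl// Rintegral_datum_hat// Rintegral_datum_hat_trunc//.
  by move: hM; lra.
apply: le_Rintegral => //; first exact: (integrableB measurableT ib2 ig).
move=> xi _; have g0 := datum_hat_gt0 xi L1.
have [inbox|outbox] := boolP [&& `|xi.1.1| <= M, `|xi.1.2| <= M * L & `|xi.2| <= M * L].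
  have /and3P[h1 h2 h3] := inbox.
  have -> : datum_hat_trunc L M xi = datum_hat L xi.
    by rewrite /datum_hat_trunc !pkernel_truncE mulr1 h1 h2 h3.
  suff : 2^-1 <= cos (th xi) by nra.
  apply: cos_ge_half; apply: le_trans small; rewrite /th.
  have leM (a b A B : R) : `|a| <= A -> `|b| <= B -> `|a * b| <= A * B.
    by move=> *; rewrite normrM ler_pM.
  have sq (a A : R) : `|a| <= A -> `|a ^+ 2| <= A ^+ 2 by rewrite !expr2; move=> h;
    exact: leM.
  apply: le_trans (ler_normD _ _) _; apply: lerD.
    rewrite normrN; apply: (leM) => //.
    do 2?[apply: le_trans (ler_normD _ _) _; apply: lerD => //]; exact: sq.
  do 2?[apply: le_trans (ler_normD _ _) _; apply: lerD]; exact: leM.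
have -> : datum_hat_trunc L M xi = 0.
  move: outbox; rewrite /datum_hat_trunc !pkernel_truncE mulr1 !negb_and.
  by case/or3P => /negbTE ->; rewrite ?mul0r ?mulr0 ?mul0r.
by rewrite mulr0 sub0r -mulrN1 ler_pM2l// cos_geN1.
Qed.

End LowerBound.

(** * Lower bound for the mixed norm *)

Section MixedNormBound.
Context {R : realType}.
Local Notation leb := (@lebesgue_measure R).
Implicit Types (L M T x : R).

(** Otherwise [B] would lie in the null set where [f] exceeds its essential supremum. *)
Lemma ess_sup_ge_on d (X : measurableType d) (mu : {measure set X -> \bar R})
    (f : X -> \bar R) (B : set X) (a : \bar R) :
  measurable B -> (0 < mu B)%E -> (forall q, B q -> a <= f q)%E -> (a <= ess_sup mu f)%E.
Proof.
move=> mB B0 Bf; rewrite leNgt; apply/negP => fa.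
have [N [mN N0 subN]] := ess_sup_ge mu f.
have BN : B `<=` N.
  by move=> q /Bf aq; apply: subN => /= /(le_trans aq); rewrite leNgt fa.
have := lt_le_trans B0 (le_measure mu (mem_set mB) (mem_set mN) BN).
by rewrite [X in (_ < X)%E]N0 ltxx.
Qed.

Lemma leb3_cube (a : R) : 0 < a ->
  (0 < leb3 (`[0%R, a] `*` `[0%R, a] `*` `[0%R, a] : set (R * R * R)))%E.
Proof.
move=> a0; rewrite [leb3 _](product_measure1E leb2 leb)//; last exact: measurableX.
rewrite [X in (X * _)%E](product_measure1E leb leb)//.
have h : (0 < leb `[0%R, a])%E by rewrite lebesgue_measure_itv/= lte_fin a0 oppr0 adde0
  lte_fin.
by apply: mule_gt0; [apply: mule_gt0|]; exact: h.
Qed.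

(** For [x] in [[0, 1/(4M)]] the modulus is at least [1/4] on a cube in [(y, z, t)] of positive
    measure. The side of the cube depends on [L], but the resulting bound does not. *)
Lemma norm_datum_evolution_ge T L M : 0 < T -> 1 <= L -> 0 < M ->
  9 / 10 * (2 * pi) ^+ 3 <= (4 * atan M) ^+ 3 ->
  ((Num.sqrt ((4 * M)^-1 / 16))%:E <= norm_L2x_LooyzT T (datum_evolution L))%E.
Proof.
move=> T0 L1 M0 hM; have L0 : 0 < L by apply: lt_le_trans L1.
(* The sum of the coefficients of [t], [y] and [z] in the smallness condition of
   [datum_evolution_ge]. *)
pose K := M ^+ 2 + (M * L) ^+ 2 + M * L + 2 * (M * L).
have K0 : 0 < K by rewrite /K !addr_gt0 ?exprn_gt0 ?mulr_gt0.
(* The cube of side [e] fits in the slab and contributes at most [e * K <= 1/2] to the phase; [x]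
   adds at most [1/4]. *)
pose e := Num.min T (2 * K)^-1.
have e0 : 0 < e by rewrite lt_min T0 invr_gt0 mulr_gt0.
have eK : e * K <= 2^-1.
  rewrite -ler_pdivlMr// -invfM; by rewrite /e ge_min lexx orbT.
have eT : e <= T by rewrite /e ge_min lexx.
pose h x := ess_sup (mrestr leb3 (measurable_slab T))
  (fun q : R * R * R => (cmodulus (datum_evolution L (x, q.1.1, q.1.2) q.2))%:E).
have hx x : 0 <= x <= (4 * M)^-1 -> (4^-1%:E <= h x)%E.
  move=> /andP[x0 xM].
  pose B : set (R * R * R) := `[0%R, e] `*` `[0%R, e] `*` `[0%R, e].
  have BT : B `<=` slab T.
    move=> -[[y z] t] [[_ _]] /=; rewrite !in_itv/= => /andP[t0 te]; split=> //=.
    by rewrite in_itv/= t0 (le_trans te).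
  have EB : mrestr leb3 (measurable_slab T) B = leb3 B by rewrite /mrestr (setIidl BT).
  apply: (@ess_sup_ge_on _ _ (mrestr leb3 (measurable_slab T)) _ B).
  - by do 2?apply: measurableX.
  - by apply: (@lt_le_trans _ _ (leb3 B)); [exact: leb3_cube|rewrite -EB].
  move=> -[[y z] t] [[By Bz] Bt].
  have /andP[y0 ye] : 0 <= y <= e by move: By; rewrite /= in_itv.
  have /andP[z0 ze] : 0 <= z <= e by move: Bz; rewrite /= in_itv.
  have /andP[t0 te] : 0 <= t <= e by move: Bt; rewrite /= in_itv.
  rewrite lee_fin; apply: le_trans _ (Re_le_cmodulus _).
  apply: le_trans _ (ler_norm _); apply: datum_evolution_ge hM _ => //.
  rewrite !ger0_norm//.
  have hx : x * M <= 4^-1.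
    by rewrite -ler_pdivlMr// -invfM.
  have A0 : 0 <= M ^+ 2 + (M * L)
    ^+ 2 + M * L by rewrite !addr_ge0 ?exprn_ge0 ?mulr_ge0 ?ltW.
  have B0 : 0 <= M * L by rewrite mulr_ge0 ?ltW.
  have h1 := ler_wpM2r A0 te; have h2 := ler_wpM2r B0 ye; have h3 := ler_wpM2r B0 ze.
  apply: le_trans (lerD h1 (lerD (lerD hx h2) h3)) _.
  rewrite (_ : _ + _ = e * K + 4^-1); last by rewrite /K; ring.
  apply: le_trans (lerD eK (lexx _)) _; lra.
have sq x : (0 <= h x ^+ 2)%E.
  rewrite expe2; case: (h x) => [r| |] /=; rewrite ?mulyy ?mulNyNy ?leey//.
  by rewrite -EFinM lee_fin -expr2 sqr_ge0.
(* A step function below the square of [h], with height [(1/4)^2] and integral equal to the square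
   of the announced bound. *)
pose k x : \bar R := (16^-1 * \1_(`[0, (4 * M)^-1] : set R) x)%:E.
have kh x : (k x <= h x ^+ 2)%E.
  rewrite /k indicE; have [|_] := boolP (x \in _); last by rewrite mulr0.
  rewrite inE/= in_itv/= => /hx hx4; rewrite mulr1.
  rewrite (_ : 16^-1 = 4^-1 * 4^-1); last by field.
  by rewrite EFinM; apply: lee_pmul; rewrite ?lee_fin.
have Ik : (\int[leb]_x k x = ((4 * M)^-1 / 16)%:E)%E.
  rewrite /k; under eq_integral do rewrite EFinM.
  rewrite ge0_integralZl//; last first.
    by apply/measurable_EFinP; exact: measurable_indic.
  have lebI : leb `[0%R, (4 * M)^-1] = (4 * M)^-1%:E.
    by rewrite lebesgue_measure_itv/= lte_fin invr_gt0 mulr_gt0// oppr0 adde0.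
  by rewrite integral_indic// setIT [X in (_ * X)%E]lebI -EFinM mulrC.
rewrite -powR12_sqrt ?divr_ge0 ?invr_ge0 ?mulr_ge0 ?(ltW M0)// -poweR_EFin.
apply: gt0_ler_poweR; rewrite ?invr_ge0//.
- by rewrite in_itv/= leey andbT lee_fin divr_ge0// invr_ge0 mulr_ge0// ltW.
- by apply/andP; split; [apply: integral_ge0 => x _; exact: sq|exact: leey].
rewrite -Ik; apply: ge0_le_integralT => x; last exact: kh.
by rewrite lee_fin mulr_ge0.
Qed.

End MixedNormBound.

(** The parameters are chosen in the order [M], then [e] from [c] and [M], then [L] from [s] and
    [e]. This is consistent because the lower bound is independent of [L]. *)
Theorem proposition2p5 (R : realType) (T : R) (hT : 0 < T) (s : R) (hs : s < 1)
    (c : R) (hc : 0 < c) :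
  exists F0 : distribution3 (R := R), sobolev s F0 /\
    exists u : R * R * R -> R -> R[i], evolution_function T F0 u /\
      (c%:E * sobolev_norm s F0 < norm_L2x_LooyzT T u)%E.
Proof.
have [M M0 hM] := @exists_large_box R.
have pi2 : 0 < 2 * pi :> R by rewrite mulr_gt0// pi_gt0.
have pi3 : 0 < (2 * pi) ^+ 3 :> R by rewrite exprn_gt0.
pose B := (4 * M)^-1 / 16.
have B0 : 0 < B by rewrite divr_gt0// invr_gt0 mulr_gt0.
(* [B] is the square of the lower bound for the mixed norm, and [e] makes the square of [c] times
   the Sobolev bound equal to [B / 2], giving the strict inequality. *)
pose e := B / (2 * c ^+ 2 * (2 * pi) ^+ 3).
have e0 : 0 < e by rewrite divr_gt0// mulr_gt0// mulr_gt0// exprn_gt0.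
have [L L1 he] := bracket2_powR_datum_hat hs e0.
have Sle := sobolev_norm_datum_le L1 he.
exists (datum_distribution L); split.
  by split; [exact: tempered_datum|apply: le_lt_trans Sle _; exact: ltry].
exists (datum_evolution L); split.
  by split=> [|t _]; [exact: cmeasurable_datum_evolution|exact: represents_datum_evolution].
apply: lt_le_trans (norm_datum_evolution_ge hT L1 M0 hM).
apply: (@le_lt_trans _ _ (c%:E * (Num.sqrt (e * (2 * pi) ^+ 3))%:E)%E).
  by rewrite lee_pmul2l ?lte_fin.
rewrite -EFinM lte_fin -[X in X * _](gtr0_norm hc) -sqrtr_sqr -sqrtrM ?sqr_ge0//.
have -> : c ^+ 2 * (e * (2 * pi) ^+ 3) = B / 2.
  by rewrite /e; move: (2 * pi) pi2 => P P0; field; rewrite !gt_eqF.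
by rewrite ltr_sqrt// ltr_pdivrMr// ltr_pMr// ltr1n.
Qed.
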